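(* Let $d=3$ and let $k\ge0$ be an integer. The refined Scott–Zhang interpolation operator $Q_0:H^1(\Omega)\to V_0$ preserves the volume mass of order $k-2$ and the face mass of order $k-1$; that is, for every $v\in H^1(\Omega)$, $$\int_T(v-Q_0v)\,p\,dx=0\qquad\forall\,T\in\mathcal T_h,\ p\in P_{k-2}(T),$$ $$\int_E(v-Q_0v)\,p\,dx=0\qquad\forall\,E\in\mathcal E_h,\ p\in P_{k-1}(E).$$
   Context: $\Omega\subset\mathbb R^3$ is a bounded polyhedral domain, $\mathcal T_h$ a (conforming) tetrahedral partition of $\Omega$, $\mathcal E_h$ the set of all face triangles of $\mathcal T_h$. $P_r$ denotes polynomials of total degree at most $r$ ($P_r=\{0\}$ if $r<0$). $V_0=\{v\in H^1(\Omega): v|_T\in P_{k+2}(T)\ \forall T\in\mathcal T_h\}$. $Q_0:H^1(\Omega)\to V_0$ is defined through values at the Lagrange nodes of the $C^0$-$P_{k+2}$ element: $Q_0v=\sum_{x_j}Q_0v(x_j)\phi_j$, with $\phi_j$ the Lagrange nodal basis. Nodes are classified as corner nodes (all nodes lying on edges, including vertices), middle nodes (nodes in the interior of a face triangle) and internal nodes (nodes in the interior of a tetrahedron). On a simplex $C$, the dual basis $\{\psi_j\}\subset P_{k+2}(C)$ of the Lagrange basis $\{\phi_j\}$ of $P_{k+2}(C)$ satisfies $\int_C\phi_j\psi_{j'}\,dx=\delta_{jj'}$. (1) For each corner node $c_j$ select one face triangle $C_j\in\mathcal E_h$ containing $c_j$, with $C_j\subset\partial\Omega$ if $c_j\in\partial\Omega$,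 and set $Q_0v(c_j)=\int_{C_j}\psi_jv\,dx$, where $\psi_j$ is the dual basis function on $C_j$ associated with $c_j$. (2) For each $E\in\mathcal E_h$, the values at the middle nodes of $E$ are the unique solution of $\int_E\big(\sum_{m\in E}Q_0v(m)\phi_m+\sum_{c\in E}Q_0v(c)\phi_c-v\big)p\,dx=0$ for all $p\in P_{k-1}(E)$ (sums over middle and corner nodes on $E$). (3) For each $T\in\mathcal T_h$, the values at the internal nodes of $T$ are the unique solution of $\int_T\big(\sum_{i}Q_0v(i)\phi_i+\sum_{m}Q_0v(m)\phi_m+\sum_{c}Q_0v(c)\phi_c-v\big)p\,dx=0$ for all $p\in P_{k-2}(T)$ (sums over internal, middle and corner nodes of $T$). *)

(* Defs.v *)
From HB Require Import structures.
From mathcomp Require Import all_boot all_order all_algebra.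
From mathcomp Require Import all_classical all_reals all_analysis.
From mathcomp Require mpoly.
Import (canonicals) mpoly.
Import Order.TTheory GRing.Theory Num.Theory numFieldNormedType.Exports.

Set Implicit Arguments.
Unset Strict Implicit.
Unset Printing Implicit Defensive.

Local Open Scope classical_set_scope.
Local Open Scope ring_scope.

(* Points are nested pairs rather than row vectors, because products (and not
   matrices) carry both a normed-module and a measurable structure. *)
Notation "'R3' R" := (R * R * R)%type (at level 10, R at level 9).

Section Space.
Variable R : realType.

Definition leb2 := (@lebesgue_measure R \x @lebesgue_measure R)%E.
Definition leb3 := (leb2 \x @lebesgue_measure R)%E.

Definition coord (x : R3 R) (i : 'I_3) : R :=
  tnth [tuple x.1.1; x.1.2; x.2] i.

Definition unitv (i : 'I_3) : R3 R :=
  ((i == 0)%:R, (i == 1)%:R, (i == 2)%:R).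

Definition cross (u v : R3 R) : R3 R :=
  (u.1.2 * v.2 - u.2 * v.1.2,
   u.2 * v.1.1 - u.1.1 * v.2,
   u.1.1 * v.1.2 - u.1.2 * v.1.1).

(* The norm of the product normed module is the maximum norm. *)
Definition enorm (u : R3 R) : R := Num.sqrt (\sum_i coord u i ^+ 2).

Definition boundary (D : set (R3 R)) : set (R3 R) := closure D `\` interior D.

(* P_r(D). The degree r is an integer; for r < 0 only p = 0 qualifies, since
   every monomial has a degree >= 0. *)
Definition polyOn (D : set (R3 R)) (r : int) (f : R3 R -> R) : Prop :=
  exists2 p : mpoly.mpoly 3 R,
    {in mpoly.msupp p, forall m, (mpoly.mdeg m)%:Z <= r} &
    forall x, D x -> f x = mpoly.meval (coord x) p.

Fixpoint Cn (n : nat) (f : R3 R -> R) : Prop :=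
  if n is n'.+1 then
    continuous f /\
    forall i, (forall x, derivable f x (unitv i)) /\ Cn n' ('D_(unitv i) f)
  else continuous f.

Definition smooth (f : R3 R -> R) : Prop := forall n, Cn n f.

Definition test_function (U : set (R3 R)) (f : R3 R -> R) : Prop :=
  smooth f /\
  exists K : set (R3 R), [/\ compact K, K `<=` U & forall x, ~ K x -> f x = 0].

Definition L2 (D : set (R3 R)) (f : R3 R -> R) : Prop :=
  f \_ D \in Lfun leb3 2%:E.

Definition L2norm (D : set (R3 R)) (f : R3 R -> R) : \bar R :=
  'N[leb3]_2%:E[EFin \o f \_ D].

Definition weak_partial (U : set (R3 R)) (i : 'I_3) (v g : R3 R -> R) : Prop :=
  forall f, test_function U f ->
    \int[leb3]_(x in U) (v x * 'D_(unitv i) f x) =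
    - \int[leb3]_(x in U) (g x * f x).

Definition H1 (U : set (R3 R)) (v : R3 R -> R) : Prop :=
  L2 U v /\ forall i, exists2 g, L2 U g & weak_partial U i v g.

Definition H1_cvg (U : set (R3 R)) (u : nat -> R3 R -> R) (v : R3 R -> R) :=
  L2norm U (u n \- v) @[n --> \oo] --> 0%E /\
  forall i, exists g, [/\ L2 U g, weak_partial U i v g &
    L2norm U ('D_(unitv i) (u n) \- g) @[n --> \oo] --> 0%E].

End Space.
Arguments leb2 R : clear implicits.
Arguments leb3 R : clear implicits.

Section Mesh.
Variables (R : realType) (V : finType) (pos : V -> R3 R).
Implicit Types (S T E : {set V}) (Th : {set {set V}}) (v g : R3 R -> R).

(* A simplex is given by the set of its vertices. *)

Definition simplex S : set (R3 R) :=
  [set x | exists w : V -> R,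
    [/\ forall i, 0 <= w i, forall i, i \notin S -> w i = 0,
        \sum_i w i = 1 & x = \sum_i w i *: pos i]].

Definition affinely_independent S : Prop :=
  forall w : V -> R, \sum_(i in S) w i = 0 -> \sum_(i in S) w i *: pos i = 0 ->
    {in S, forall i, w i = 0}.

Definition tetrahedron S : Prop := #|S| = 4 /\ affinely_independent S.

Definition tetrahedral_partition (Om : set (R3 R)) Th : Prop :=
  [/\ {in Th, forall T, tetrahedron T},
      closure Om = \bigcup_(T in [set` Th]) simplex T &
      {in Th &, forall T1 T2,
         simplex T1 `&` simplex T2 = simplex (T1 :&: T2)%SET}].

Definition edges Th : {set {set V}} :=
  [set e : {set V} | (#|e| == 2)%N & [exists T in Th, e \subset T]]%SET.
Definition faces Th : {set {set V}} :=
  [set E : {set V} | (#|E| == 3)%N & [exists T in Th, E \subset T]]%SET.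

(* On a cell we integrate over the open tetrahedron: the functions of
   H^1(Omega) are given on the open set Omega only. *)
Definition cell T : set (R3 R) := interior (simplex T).

Definition cell_int T (f : R3 R -> R) : R := \int[leb3 R]_(x in cell T) f x.

(* The surface integral over a face with vertices a, b, c is pulled back to the
   reference triangle by (s, t) |-> a + s (b - a) + t (c - a), whose area
   element is |(b - a) x (c - a)|. *)
Definition ref_triangle : set (R * R) :=
  [set z | [/\ 0 <= z.1, 0 <= z.2 & z.1 + z.2 <= 1]].

Definition vtx S (n : nat) : R3 R := nth 0 [seq pos i | i in S] n.

Definition face_map E (z : R * R) : R3 R :=
  vtx E 0 + z.1 *: (vtx E 1 - vtx E 0) + z.2 *: (vtx E 2 - vtx E 0).

Definition face_jac E : R :=
  enorm (cross (vtx E 1 - vtx E 0) (vtx E 2 - vtx E 0)).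

Definition face_int E (f : R3 R -> R) : R :=
  face_jac E * \int[leb2 R]_(z in ref_triangle) f (face_map E z).

(* The constant Jacobian affects neither membership in L^2(E) nor convergence
   in it, and is omitted here. *)
Definition face_L2 E g : Prop :=
  (g \o face_map E) \_ ref_triangle \in Lfun (leb2 R) 2%:E.
Definition face_L2norm E g : \bar R :=
  'N[leb2 R]_2%:E[EFin \o (g \o face_map E) \_ ref_triangle].

(* g is the trace of v on the face E: from each tetrahedron T with face E, it is
   the L^2(E)-limit of u_n|_E for smooth u_n converging to v in H^1(T). *)
Definition is_trace Th E v g : Prop :=
  face_L2 E g /\
  forall T, T \in Th -> E \subset T ->
    exists u : nat -> R3 R -> R,
      [/\ forall n, smooth (u n), H1_cvg (cell T) u v &
          face_L2norm E (u n \- g) @[n --> \oo] --> 0%E].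

(* The trace exists, and is unique almost everywhere on E, for v in
   H^1(Omega). *)
Definition trace Th E v : R3 R -> R := xget (cst 0) [set g | is_trace Th E v g].

(* The conforming Lagrange space V_0. Its elements are represented by their
   continuous versions: the restriction to each closed tetrahedron is
   everywhere, not just almost everywhere, a polynomial. *)
Definition V0 (k : nat) (Om : set (R3 R)) Th v : Prop :=
  H1 Om v /\ {in Th, forall T, polyOn (simplex T) k.+2 v}.

Section Nodes.
Variable k : nat.

(* The Lagrange nodes of degree k + 2 of a simplex are the points with
   barycentric coordinates in (1 / (k + 2)) N; a node is represented by its
   barycentric coordinates multiplied by k + 2. *)
Definition node : predArgType := {ffun V -> 'I_k.+3}.
Implicit Types a b : node.

Definition nsupp a : {set V} := [set i | a i != 0%N :> nat]%SET.

Definition npoint a : R3 R := \sum_i ((a i)%:R / k.+2%:R) *: pos i.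

Definition nodes_on S : {set node} :=
  [set a : node | (\sum_i a i == k.+2)%N & nsupp a \subset S]%SET.

Definition nodes Th : {set node} :=
  [set a : node | [exists T in Th, a \in nodes_on T]]%SET.

Definition corner_node Th a : bool :=
  (a \in nodes Th) && [exists e in edges Th, nsupp a \subset e].
Definition middle_node Th a : bool :=
  (a \in nodes Th) && (nsupp a \in faces Th).
Definition internal_node Th a : bool :=
  (a \in nodes Th) && (nsupp a \in Th).

Definition nodal_basis Om Th (phi : node -> R3 R -> R) : Prop :=
  {in nodes Th, forall a, V0 k Om Th (phi a)} /\
  {in nodes Th &, forall a b, phi a (npoint b) = (a == b)%:R}.

(* psi E b is the dual basis function on the face E associated with b; the
   Lagrange basis of P_{k+2}(E) consists of the restrictions of phi. *)
Definition dual_basis Th (phi : node -> R3 R -> R)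
    (psi : {set V} -> node -> R3 R -> R) : Prop :=
  {in faces Th, forall E,
    {in nodes_on E, forall b, polyOn (simplex E) k.+2 (psi E b)} /\
    {in nodes_on E &, forall a b,
       face_int E (fun x => phi a x * psi E b x) = (a == b)%:R}}.

Definition face_selection Om Th (C : node -> {set V}) : Prop :=
  forall a, corner_node Th a ->
    [/\ C a \in faces Th, nsupp a \subset C a &
        boundary Om (npoint a) -> simplex (C a) `<=` boundary Om].

Section ScottZhang.
Variables (Th : {set {set V}}) (phi : node -> R3 R -> R).
Variables (psi : {set V} -> node -> R3 R -> R) (C : node -> {set V}).

Definition corner_value v a : R :=
  face_int (C a) (fun x => psi (C a) a x * trace Th (C a) v x).

Definition middle_system v E (q : node -> R) : Prop :=
  (forall a, ~~ ((a \in nodes_on E) && middle_node Th a) -> q a = 0) /\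
  forall p, polyOn (simplex E) (k%:Z - 1) p ->
    face_int E (fun x =>
      (\sum_(m in nodes_on E | middle_node Th m) q m * phi m x
       + \sum_(c in nodes_on E | corner_node Th c) corner_value v c * phi c x
       - trace Th E v x) * p x) = 0.

(* The solution of the (uniquely solvable) linear system. *)
Definition middle_solution v E : node -> R := xget (cst 0) (middle_system v E).

Definition middle_value v a : R := middle_solution v (nsupp a) a.

Definition internal_system v T (q : node -> R) : Prop :=
  (forall a, ~~ ((a \in nodes_on T) && internal_node Th a) -> q a = 0) /\
  forall p, polyOn (simplex T) (k%:Z - 2) p ->
    cell_int T (fun x =>
      (\sum_(i in nodes_on T | internal_node Th i) q i * phi i x
       + \sum_(m in nodes_on T | middle_node Th m) middle_value v m * phi m x
       + \sum_(c in nodes_on T | corner_node Th c) corner_value v c * phi c x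
       - v x) * p x) = 0.

Definition internal_solution v T : node -> R :=
  xget (cst 0) (internal_system v T).

Definition internal_value v a : R := internal_solution v (nsupp a) a.

Definition Q0_value v a : R :=
  if corner_node Th a then corner_value v a
  else if middle_node Th a then middle_value v a
  else internal_value v a.

Definition Q0 v : R3 R -> R :=
  fun x => \sum_(a in nodes Th) Q0_value v a * phi a x.

End ScottZhang.
End Nodes.
End Mesh.

(* A bounded domain that is the interior of a finite union of closed
   tetrahedra. *)
Definition polyhedral_domain (R : realType) (Om : set (R3 R)) : Prop :=
  [/\ Om !=set0, open Om, connected Om, bounded_set Om &
      interior (closure Om) = Om /\
      exists (W : finType) (pos : W -> R3 R) (F : {set {set W}}),
        {in F, forall S, tetrahedron pos S} /\
        closure Om = \bigcup_(S in [set` F]) simplex pos S].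

(* Main.v *)
(* On a simplex S with |S| vertices the test space has degree k + 2 - |S|, so
   bubble * p, where the bubble is the product of the barycentric coordinates,
   has degree at most k + 2 and vanishes at all nodes of the boundary of S.
   Unisolvence of the Lagrange nodes makes it a combination of the interior
   nodal functions.  If p is orthogonal to all of these, the integral of
   bubble * p^2 vanishes and p = 0 almost everywhere.  By the Fredholm
   alternative the systems defining the middle and internal values are
   solvable for every integrable right-hand side.  Since the other nodal
   functions vanish on S, these systems are the two mass identities. *)
Require Import Defs.
From HB Require Import structures.
From mathcomp Require Import all_boot all_order all_algebra.
From mathcomp Require Import all_classical all_reals all_analysis.
From mathcomp Require Import measurable_realfun ring lra zify.
From mathcomp Require mpoly.
Import (canonicals) mpoly.
Import Order.TTheory GRing.Theory Num.Theory numFieldNormedType.Exports.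

Set Implicit Arguments.
Unset Strict Implicit.
Unset Printing Implicit Defensive.

Local Open Scope classical_set_scope.
Local Open Scope ring_scope.

(** The middle and internal values are picked by [xget], so the mass identities hold as soon as each
    system has some solution; existence is the whole content. Polynomials are given in the
    coordinates of space, which are dependent on the plane of a face, while nodes are given by
    barycentric coordinates. All comparisons of polynomials therefore take place among functions of
    the weights [V -> R], where a node is a scaled lattice point.

    Faces and cells share one argument: a simplex S is reached through a map [G] from a set [D] of
    finite measure. For a face, [D] is the reference triangle and [G] is [face_map]; for a cell, [D]
    is the open cell and [G] the identity. The null set [N] collects the points where a barycentric
    weight may vanish, so that the bubble can be cancelled elsewhere. *)

(** * Polynomials in finitely many variables and the Newton basis *)

Section PolynomialFunctions.
Variables (R : realType) (I : finType).
Implicit Types (f g : (I -> R) -> R) (n : nat).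

(** A predicate on functions with the degree as an upper bound: no representing polynomial has to be
    chosen, and the variables can be indexed directly by vertices. *)
Inductive poly_fun : nat -> ((I -> R) -> R) -> Prop :=
| poly_fun_cst n c : poly_fun n (fun=> c)
| poly_fun_add n f g :
    poly_fun n f -> poly_fun n g -> poly_fun n (fun y => f y + g y)
| poly_fun_var n i f : poly_fun n f -> poly_fun n.+1 (fun y => y i * f y).

Lemma eq_poly_fun n f g : f =1 g -> poly_fun n f -> poly_fun n g.
Proof. by move=> /funext ->. Qed.

Lemma poly_fun_scale n c f : poly_fun n f -> poly_fun n (fun y => c * f y).
Proof.
elim => [{}n d|{}n {}f g _ IHf _ IHg|{}n i {}f _ IHf].
- exact: poly_fun_cst.
- under eq_fun do rewrite mulrDr; exact: poly_fun_add.
- under eq_fun do rewrite mulrCA; exact: poly_fun_var.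
Qed.

Lemma poly_fun_le m n f : (m <= n)%N -> poly_fun m f -> poly_fun n f.
Proof.
move=> mn pf; elim: pf n mn =>
  [{}m d n _|{}m {}f g _ IHf _ IHg n mn|{}m i {}f _ IHf [//|n] mn].
- exact: poly_fun_cst.
- by apply: poly_fun_add; [exact: IHf|exact: IHg].
- by apply: poly_fun_var; exact: IHf.
Qed.

Lemma poly_fun_sum (J : Type) (r : seq J) (P : pred J) n
    (F : J -> (I -> R) -> R) :
  (forall j, P j -> poly_fun n (F j)) ->
  poly_fun n (fun y => \sum_(j <- r | P j) F j y).
Proof.
move=> PF; elim: r => [|j r IH].
  by apply: eq_poly_fun (poly_fun_cst n 0) => y; rewrite big_nil.
under eq_fun do rewrite big_cons.
by case: (boolP (P j)) => // Pj; apply: poly_fun_add => //; exact: PF.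
Qed.

Lemma poly_fun_mul m n f g : poly_fun m f -> poly_fun n g ->
  poly_fun (m + n) (fun y => f y * g y).
Proof.
move=> pf pg; elim: pf =>
  [{}m c|{}m {}f h _ IHf _ IHh|{}m i {}f _ IHf].
- exact: poly_fun_le (leq_addl m n) (poly_fun_scale c pg).
- by under eq_fun do rewrite mulrDl; exact: poly_fun_add.
- by under eq_fun do rewrite -mulrA; exact: poly_fun_var.
Qed.

Lemma poly_fun_exp m n f : poly_fun m f -> poly_fun (m * n) (fun y => f y ^+ n).
Proof.
move=> pf; elim: n => [|n IHn].
  by apply: eq_poly_fun (poly_fun_cst _ 1) => y; rewrite expr0.
by rewrite mulnS; under eq_fun do rewrite exprS; exact: poly_fun_mul.
Qed.

Lemma poly_fun_prod (J : Type) (r : seq J) (P : pred J) (d : J -> nat)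
    (F : J -> (I -> R) -> R) :
  (forall j, P j -> poly_fun (d j) (F j)) ->
  poly_fun (\sum_(j <- r | P j) d j) (fun y => \prod_(j <- r | P j) F j y).
Proof.
move=> PF; elim: r => [|j r IH].
  by apply: eq_poly_fun (poly_fun_cst _ 1) => y; rewrite big_nil.
rewrite big_cons; under [X in poly_fun _ X]eq_fun do rewrite big_cons.
by case: (boolP (P j)) => // Pj; apply: poly_fun_mul => //; exact: PF.
Qed.

Lemma poly_fun_coord i : poly_fun 1 (fun y => y i).
Proof.
by apply: eq_poly_fun (poly_fun_var i (poly_fun_cst 0 1)) => y; rewrite mulr1.
Qed.

(** The falling factorial of a real argument; at a natural number m it vanishes exactly when m < n,
    which makes it the Newton basis for the nodes 0, 1, 2, ... *)
Definition ffactr (x : R) (n : nat) : R := \prod_(j < n) (x - j%:R).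

Lemma ffactrS x n : ffactr x n.+1 = ffactr x n * (x - n%:R).
Proof. by rewrite /ffactr big_ord_recr. Qed.

Lemma ffactr_nat_eq0 (m n : nat) : (ffactr m%:R n == 0) = (m < n)%N.
Proof.
elim: n => [|n IHn]; first by rewrite /ffactr big_ord0 oner_eq0.
by rewrite ffactrS mulf_eq0 IHn subr_eq0 eqr_nat ltnS orbC -leq_eqVlt.
Qed.

Definition newton (a : {ffun I -> nat}) (y : I -> R) : R :=
  \prod_i ffactr (y i) (a i).

(** In the factor i this is x * (x)_n = (x)_(n+1) + n * (x)_n for falling factorials. *)
Lemma mulr_newton i (a : {ffun I -> nat}) (y : I -> R) :
  y i * newton a y =
  newton [ffun j => (a j + (j == i))%N] y + (a i)%:R * newton a y.
Proof.
rewrite /newton (bigD1 i)//= [X in _ = X + _](bigD1 i)//= ffunE eqxx addn1.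
rewrite [X in _ = _ * X + _](eq_bigr (fun j => ffactr (y j) (a j))); last first.
  by move=> j /negPf ji; rewrite ffunE ji addn0.
by rewrite ffactrS; ring.
Qed.

Lemma poly_fun_newton n f : poly_fun n f ->
  exists s : seq (R * {ffun I -> nat}),
    {in s, forall t : R * {ffun I -> nat}, (\sum_i t.2 i <= n)%N} /\
    forall y, f y = \sum_(t <- s) t.1 * newton t.2 y.
Proof.
elim => [{}n c|{}n {}f g _ [s [sn sf]] _ [s' [sn' sg]]|{}n i {}f _ [s [sn sf]]].
- exists [:: (c, [ffun=> 0%N])]; split=> [t|y].
    by rewrite inE => /eqP -> /=; rewrite big1// => i _; rewrite ffunE.
  rewrite big_seq1 /newton big1 ?mulr1// => i _.
  by rewrite ffunE /ffactr big_ord0.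
- exists (s ++ s'); split=> [t|y]; last by rewrite big_cat/= sf sg.
  by rewrite mem_cat => /orP[/sn|/sn'].
(* Multiplication by [y i] sends each term to two, by [mulr_newton]. The list may thus repeat an
   index. *)
- exists ([seq (t.1, [ffun j => (t.2 j + (j == i))%N])
           | t : R * {ffun I -> nat} <- s] ++
          [seq (t.1 * (t.2 i)%:R, t.2) | t : R * {ffun I -> nat} <- s]);
    split=> [t|y].
    rewrite mem_cat => /orP[] /mapP[u /sn un ->] /=; last exact: leqW.
    under eq_bigr do rewrite ffunE.
    by rewrite big_split/= -big_mkcond big_pred1_eq addn1.
  rewrite big_cat !big_map/= sf mulr_sumr -big_split/=; apply: eq_bigr => t _.
  by rewrite mulrCA mulr_newton; ring.
Qed.

(* In the Newton basis, evaluation at the lattice points is triangular. *)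
Lemma poly_fun_lattice_eq0 n f : poly_fun n f ->
  (forall a : I -> nat, (\sum_i a i <= n)%N -> f (fun i => (a i)%:R) = 0) ->
  forall y, f y = 0.
Proof.
move=> /poly_fun_newton[s [sn sf]] f0.
(* Repeated indices are gathered: [c a] is the total coefficient of the Newton polynomial [a], and
   [r] lists the distinct indices. *)
pose c a := \sum_(t <- s | t.2 == a) t.1.
pose r := undup [seq t.2 | t <- s].
have fE y : f y = \sum_(a <- r) c a * newton a y.
  rewrite sf; under [RHS]eq_bigr do rewrite mulr_suml.
  rewrite (exchange_big_dep xpredT)//=; apply: eq_big_seq => t ts.
  rewrite big_mkcond (big_rem (t.2 : {ffun I -> nat}))/=; last first.
    by rewrite mem_undup map_f.
  rewrite eqxx big1_seq ?addr0// => a ar; case: eqP ar => // <-.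
  by rewrite mem_rem_uniqF ?undup_uniq.
have rn : {in r, forall a : {ffun I -> nat}, (\sum_i a i <= n)%N}.
  by move=> a; rewrite mem_undup => /mapP[t /sn ? ->].
suff c0 : {in r, forall a, c a = 0}.
  by move=> y; rewrite fE big_seq big1// => a /c0 ->; rewrite mul0r.
(* Strong induction on the total degree of [a], evaluating at the lattice point [a]. There
   [newton a] is nonzero. Another index [b] contributes nothing: either its total degree is smaller
   and [c b] is already known to vanish, or some [b i] exceeds [a i] and [newton b] vanishes. *)
move=> a; have [m] := ubnP (\sum_i a i); elim: m a => // m IHm a am ar.
have /eqP := f0 a (rn a ar); rewrite fE (big_rem a)//= big1_seq => [|b].
  rewrite addr0 mulf_eq0 => /orP[/eqP//|]; rewrite prodf_seq_eq0.
  by move=> /hasP[i _ /=]; rewrite ffactr_nat_eq0 ltnn.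
rewrite andTb mem_rem_uniq ?undup_uniq// inE => /andP[ba br].
have [lt_ba|le_ab] := ltnP (\sum_i b i) (\sum_i a i).
  by rewrite IHm ?mul0r// (leq_trans lt_ba).
suff [i abi] : exists i, (a i < b i)%N.
  apply/eqP; rewrite mulf_eq0 prodf_seq_eq0; apply/orP; right.
  by apply/hasP; exists i; rewrite ?mem_index_enum//= ffactr_nat_eq0.
apply: contrapT => /forallNP ab; move/negP: ba; apply; apply/eqP/ffunP => i.
have leba j : (b j <= a j)%N by rewrite leqNgt; exact/negP/ab.
apply/eqP; rewrite eqn_leq leba leqNgt; apply/negP => lt.
suff : (\sum_i b i < \sum_i a i)%N by rewrite ltnNge le_ab.
rewrite (bigD1 i)//= [X in (_ < X)%N](bigD1 i)//= -addSn.
by apply: leq_add => //; apply: leq_sum => j _; exact: leba.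
Qed.

End PolynomialFunctions.

Lemma poly_fun_comp (R : realType) (I J : finType) (n : nat)
    (f : (I -> R) -> R) (A : (J -> R) -> I -> R) :
  (forall i, poly_fun 1 (A^~ i)) -> poly_fun n f -> poly_fun n (f \o A).
Proof.
move=> pA; elim=> [{}n c|{}n {}f g _ pf _ pg|{}n i {}f _ pf].
- exact: poly_fun_cst.
- exact: poly_fun_add.
- by rewrite -add1n; exact: poly_fun_mul (pA i) pf.
Qed.

(** * Unisolvence of the Lagrange nodes of a simplex *)

Section NodeUnisolvence.
Variables (R : realType) (V : finType) (k : nat).
Implicit Types (S : {set V}) (w y : V -> R).

Definition weights_of_node (a : node V k) : V -> R :=
  fun i => (a i)%:R / k.+2%:R.

(** Affine parametrisation of the weights on S with sum 1: the vertices of S other than [i0] are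
    free and [i0] takes the remainder. The scaling by k + 2 turns lattice points into nodes. *)
Let bary S i0 y i : R :=
  if i \in S :\ i0 then y i / k.+2%:R
  else if i == i0 then 1 - \sum_(j in S :\ i0) y j / k.+2%:R else 0.

Lemma sum_nodes_on S (a : node V k) : a \in nodes_on k S ->
  (\sum_i a i = k.+2)%N.
Proof. by rewrite inE => /andP[/eqP]. Qed.

Lemma nsupp_nodes_on S (a : node V k) : a \in nodes_on k S -> nsupp a \subset S.
Proof. by rewrite inE => /andP[]. Qed.

Lemma weights_of_node_ge0 (a : node V k) i : 0 <= weights_of_node a i.
Proof. by rewrite /weights_of_node divr_ge0. Qed.

Lemma weights_of_node_eq0 (a : node V k) i :
  (weights_of_node a i == 0) = (i \notin nsupp a).
Proof.
by rewrite inE negbK mulf_eq0 invr_eq0 !pnatr_eq0 orbF.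
Qed.

Lemma sum_weights_of_node S (a : node V k) : a \in nodes_on k S ->
  \sum_i weights_of_node a i = 1.
Proof.
by move=> /sum_nodes_on aS; rewrite -mulr_suml -natr_sum aS divff// pnatr_eq0.
Qed.

(** The entries of [a] at [i0] and outside S are discarded; the entry of the node at [i0] is what
    the others leave of k + 2. *)
Let bary_lattice S i0 (a : V -> nat) : i0 \in S -> (\sum_i a i <= k.+2)%N ->
  exists2 b : node V k, b \in nodes_on k S &
    weights_of_node b = bary S i0 (fun i => (a i)%:R).
Proof.
move=> i0S ak; set s := (\sum_(i in S :\ i0) a i)%N.
have sk : (s <= k.+2)%N.
  by apply: leq_trans ak; rewrite [leqRHS](bigID (mem (S :\ i0)))/= leq_addr.
pose b0 i := if i \in S :\ i0 then a i else if i == i0 then (k.+2 - s)%N else 0%N.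
have b0k i : (b0 i < k.+3)%N.
  rewrite /b0 ltnS; case: ifPn => iS; last by case: ifP; rewrite ?leq_subr.
  by apply: leq_trans ak; rewrite (bigD1 i)//= leq_addr.
exists [ffun i => Ordinal (b0k i)]; last first.
  apply/funext => i; rewrite /weights_of_node /bary ffunE/= /b0.
  case: ifPn => // _; case: ifPn => // _; last by rewrite mul0r.
  by rewrite natrB// mulrBl divff ?pnatr_eq0// /s natr_sum mulr_suml.
rewrite inE; apply/andP; split; last first.
  apply/fintype.subsetP => i; rewrite inE ffunE/= /b0 !inE.
  by have [->|_] := eqVneq i i0; [rewrite i0S|case: (i \in S)].
under eq_bigr do rewrite ffunE/=.
rewrite (bigID (mem (S :\ i0)))/= (eq_bigr a); last first.
  by move=> i iS; rewrite /b0 iS.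
rewrite -/s [X in (_ + X)%N](bigD1 i0) ?inE ?eqxx//= big1; last first.
  by move=> i /andP[/negPf iS /negPf ii0]; rewrite /b0 iS ii0.
by rewrite addn0 /b0 !inE eqxx/= subnKC.
Qed.

(** Pulled back along [bary], g is a polynomial of degree at most k + 2 vanishing at all lattice
    points of total at most k + 2, hence everywhere. The weights may be negative, as the argument is
    purely algebraic. *)
Lemma node_unisolvence S (g : (V -> R) -> R) : poly_fun k.+2 g ->
  {in nodes_on k S, forall a, g (weights_of_node a) = 0} ->
  forall w, (forall i, i \notin S -> w i = 0) -> \sum_i w i = 1 -> g w = 0.
Proof.
move=> pg g0 w wS w1.
have [i0 i0S] : exists i0, i0 \in S.
  apply: contrapT => /forallNP S0; have := oner_neq0 R.
  by rewrite -w1 big1 ?eqxx// => i _; apply: wS; exact/negP/S0.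
have n0 : k.+2%:R != 0 :> R by rewrite pnatr_eq0.
have -> : w = bary S i0 (fun i => k.+2%:R * w i).
  apply/funext => i; rewrite /bary; case: ifPn => iS.
    by rewrite mulrAC divff// mul1r.
  under eq_bigr do rewrite mulrAC divff// mul1r.
  case: ifPn => [/eqP ->|ii0]; last first.
    by apply: wS; move: iS; rewrite !inE ii0.
  rewrite -w1 (bigID (mem (S :\ i0)))/= addrC addrK (bigD1 i0) ?inE ?eqxx//=.
  rewrite big1 ?addr0// => j /andP[jS ji0]; apply: wS.
  by move: jS; rewrite !inE ji0.
apply: (@poly_fun_lattice_eq0 _ _ k.+2 (g \o bary S i0)) => [|a ak]; last first.
  by have [b bS /= <-] := bary_lattice i0S ak; exact: g0.
apply: (poly_fun_comp _ pg) => i; rewrite /bary.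
case: (i \in S :\ i0).
  by apply: (@eq_poly_fun _ _ _ (fun y => k.+2%:R^-1 * y i)) => [y|];
    [rewrite mulrC|exact/poly_fun_scale/poly_fun_coord].
case: (i == i0); last exact: poly_fun_cst.
apply: poly_fun_add; first exact: poly_fun_cst.
apply: (@eq_poly_fun _ _ _
    (fun y => \sum_(j in S :\ i0) (- k.+2%:R^-1) * y j)) => [y|].
  by rewrite -sumrN; apply: eq_bigr => j _; rewrite mulrC mulrN.
by apply: poly_fun_sum => j _; exact/poly_fun_scale/poly_fun_coord.
Qed.

End NodeUnisolvence.

(** * Polynomials in space as polynomials in the weights *)

Section NodePolynomials.
Variables (R : realType) (V : finType) (pos : V -> R3 R).

Definition point_of (w : V -> R) : R3 R := \sum_i w i *: pos i.

Lemma coord_point_of w i :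
  Defs.coord (point_of w) i = \sum_j w j * Defs.coord (pos j) i.
Proof.
rewrite /point_of; elim/big_ind2 : _ => [|x a y b <- <-|j _] /=.
- by case: i => -[|[|[|//]]] ?; rewrite /Defs.coord !(tnth_nth 0).
- by case: i => -[|[|[|//]]] ?; rewrite /Defs.coord !(tnth_nth 0).
- by case: i => -[|[|[|//]]] ?; rewrite /Defs.coord !(tnth_nth 0).
Qed.

(** The coordinates of [point_of w] are linear in w, so the substitution does not raise the
    degree. *)
Lemma poly_fun_meval (d : nat) (p : mpoly.mpoly 3 R) :
  {in mpoly.msupp p, forall m, (mpoly.mdeg m <= d)%N} ->
  poly_fun d (fun w => mpoly.meval (Defs.coord (point_of w)) p).
Proof.
move=> pd; under eq_fun do rewrite mpoly.mevalE big_seq.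
apply: poly_fun_sum => m /pd md; apply: poly_fun_scale.
apply: poly_fun_le md _; rewrite mpoly.mdegE.
apply: poly_fun_prod => i _; rewrite -[X in poly_fun X]mul1n.
apply: poly_fun_exp; under eq_fun do rewrite coord_point_of.
apply: poly_fun_sum => j _; under eq_fun do rewrite mulrC.
exact/poly_fun_scale/poly_fun_coord.
Qed.

End NodePolynomials.

(** * Simplices as sets of weighted points, and polynomials on them *)

Section SimplexWeights.
Variables (R : realType) (V : finType) (pos : V -> R3 R).
Implicit Types (S : {set V}) (w : V -> R).

Definition weights S w : Prop :=
  [/\ forall i, 0 <= w i, forall i, i \notin S -> w i = 0 & \sum_i w i = 1].

Lemma simplexE S : simplex pos S = point_of pos @` weights S.
Proof.
apply/seteqP; split=> x [w].
  by case=> w0 wS w1 ->; exists w.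
by case=> w0 wS w1 <-; exists w.
Qed.

Lemma weights_le1 S w i : weights S w -> w i <= 1.
Proof.
by case=> w0 _ <-; rewrite (bigD1 i)//= lerDl sumr_ge0.
Qed.

Lemma weights_node k S (a : node V k) : a \in nodes_on k S ->
  weights S (weights_of_node R a).
Proof.
move=> aS; split=> [i|i iS|]; first exact: weights_of_node_ge0.
  apply/eqP; rewrite weights_of_node_eq0; apply: contra iS.
  exact/fintype.subsetP/(nsupp_nodes_on aS).
exact: sum_weights_of_node aS.
Qed.

Lemma npointE k (a : node V k) : npoint pos a = point_of pos (weights_of_node R a).
Proof. by []. Qed.

Lemma polyOn_poly_fun S (d : nat) (f : R3 R -> R) : polyOn (simplex pos S) d f ->
  exists2 g, poly_fun d g & forall w, weights S w -> f (point_of pos w) = g w.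
Proof.
case=> p pd fp; exists (fun w => mpoly.meval (Defs.coord (point_of pos w)) p).
  by apply: poly_fun_meval => m /pd; rewrite lez_nat.
by move=> w Sw; apply: fp; rewrite simplexE; exists w.
Qed.

Lemma polyOn_subset (D D' : set (R3 R)) (r : int) (f : R3 R -> R) :
  D' `<=` D -> polyOn D r f -> polyOn D' r f.
Proof. by move=> DD' [p pr fp]; exists p => // x /DD' /fp. Qed.

Lemma polyOn0 (D : set (R3 R)) r : polyOn D r (cst 0).
Proof. by exists 0 => [m|x _]; rewrite ?mpoly.msupp0// mpoly.meval0. Qed.

Lemma polyOnD (D : set (R3 R)) r f g : polyOn D r f -> polyOn D r g ->
  polyOn D r (f \+ g).
Proof.
move=> [p pr fp] [q qr gq]; exists (p + q) => [m /mpoly.msuppD_le|x Dx].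
  by rewrite mem_cat => /orP[/pr|/qr].
by rewrite mpoly.mevalD -fp// -gq.
Qed.

Lemma polyOnZ (D : set (R3 R)) r (c : R) f : polyOn D r f ->
  polyOn D r (fun x => c * f x).
Proof.
move=> [p pr fp]; exists (c *: p) => [m /mpoly.msuppZ_le/pr//|x Dx].
by rewrite mpoly.mevalZ -fp.
Qed.

Lemma polyOn_lincomb (D : set (R3 R)) r (J : Type) (s : seq J) (P : pred J)
    (c : J -> R) (f : J -> R3 R -> R) : (forall j, P j -> polyOn D r (f j)) ->
  polyOn D r (fun x => \sum_(j <- s | P j) c j * f j x).
Proof.
move=> fP; elim: s => [|j s IHs].
  by rewrite (_ : (fun x => _) = cst 0); [exact: polyOn0|
    apply/funext => x; rewrite big_nil].
have [Pj|nPj] := boolP (P j); last first.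
  by rewrite (_ : (fun x => _) =
      (fun x => \sum_(j <- s | P j) c j * f j x))//; apply/funext => x;
    rewrite big_cons (negPf nPj).
rewrite (_ : (fun x => _) =
    (fun x => c j * f j x) \+ (fun x => \sum_(j <- s | P j) c j * f j x)).
  by apply: polyOnD => //; apply: polyOnZ; exact: fP.
by apply/funext => x; rewrite big_cons Pj.
Qed.

(** All weights lie in [0, 1], so multiplication by a variable preserves a bound. *)
Lemma poly_fun_bounded n (g : (V -> R) -> R) : poly_fun n g ->
  exists M, forall S w, weights S w -> `|g w| <= M.
Proof.
elim=> [{}n c|{}n {}f h _ [M fM] _ [M' hM]|{}n i {}f _ [M fM]].
- by exists `|c|.
- exists (M + M') => S w Sw; rewrite (le_trans (ler_normD _ _))// lerD//.
    exact: fM Sw.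
  exact: hM Sw.
- exists M => S w Sw; rewrite normrM; case: (Sw) => w0 _ _.
  rewrite ger0_norm// (le_trans _ (fM S w Sw))// ler_piMl//.
  exact: weights_le1 Sw.
Qed.

Lemma polyOn_bounded S (r : int) (f : R3 R -> R) : polyOn (simplex pos S) r f ->
  exists M, forall x, simplex pos S x -> `|f x| <= M.
Proof.
case=> p _ fp.
(* [r] may be negative; the largest degree in the support of [p] is a natural number bounding the
   degree. *)
have : poly_fun (\max_(m <- mpoly.msupp p) mpoly.mdeg m)
    (fun w => mpoly.meval (Defs.coord (point_of pos w)) p).
  by apply: poly_fun_meval => m mp; exact: leq_bigmax_seq.
move=> /poly_fun_bounded[M pM]; exists M => x Sx; rewrite fp//.
by move: Sx; rewrite simplexE => -[w Sw <-]; exact: pM Sw.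
Qed.

End SimplexWeights.
(** A row vector lies in the row space of a matrix exactly when it annihilates the cokernel, whose
    columns are vectors c as in the hypothesis. Rows outside [P] are set to zero, which confines the
    solution to [P]. *)
Lemma fredholm_alternative (F : fieldType) (I J : finType) (P : pred I)
    (A : I -> J -> F) (L : J -> F) :
  (forall c : J -> F, (forall i, P i -> \sum_j A i j * c j = 0) ->
    \sum_j L j * c j = 0) ->
  exists2 q : I -> F, (forall i, ~~ P i -> q i = 0) &
    forall j, \sum_(i | P i) q i * A i j = L j.
Proof.
move=> AL.
pose M : 'M[F]_(#|I|, #|J|) :=
  \matrix_(i, j) if P (enum_val i) then A (enum_val i) (enum_val j) else 0.
pose l : 'rV[F]_#|J| := \row_j L (enum_val j).
have /submxP[u uM] : (l <= M)%MS.
  rewrite submxE; apply/eqP/rowP => j; rewrite !mxE.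
  have Mc i : \sum_j' M i j' * cokermx M j' j = 0.
    by have /matrixP/(_ i j) := mulmx_coker M; rewrite !mxE.
  pose c j' := cokermx M (enum_rank j') j.
  rewrite (reindex _ (onW_bij _ (enum_rank_bij J)))/=.
  under eq_bigr do rewrite mxE enum_rankK.
  apply: AL => i Pi; rewrite -[RHS](Mc (enum_rank i)).
  rewrite [RHS](reindex _ (onW_bij _ (enum_rank_bij J)))/=.
  by apply: eq_bigr => j' _; rewrite [M _ _]mxE !enum_rankK Pi.
exists (fun i => if P i then u 0 (enum_rank i) else 0) => [i /negPf ->//|j].
have /rowP/(_ (enum_rank j)) := uM; rewrite !mxE enum_rankK => ->.
rewrite big_mkcond [RHS](reindex _ (onW_bij _ (enum_rank_bij I)))/=.
apply: eq_bigr => i _.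
by rewrite [M _ _]mxE !enum_rankK; case: (P i); rewrite ?mulr0.
Qed.

(** * Integrals of linear combinations, and L2 inside L1 *)

Section Integrals.
Context d (T : measurableType d) (R : realType) (mu : {measure set T -> \bar R}).
Implicit Types (D : set T) (f g : T -> R).

Lemma bounded_on D f (M : R) : (forall z, D z -> `|f z| <= M) ->
  [bounded f z | z in D].
Proof.
move=> fM; exists M; split=> [|x Mx z /fM/le_trans]; rewrite ?num_real//.
by apply; exact: ltW.
Qed.

(** Additivity of the real-valued integral requires integrable summands, so the induction carries
    integrability of the partial sums along with the formula. *)
Lemma Rintegral_lincomb D (J : Type) (r : seq J) (P : pred J) (c : J -> R)
    (f : J -> T -> R) : measurable D ->
  (forall j, P j -> mu.-integrable D (EFin \o f j)) ->
  mu.-integrable D (EFin \o (fun x => \sum_(j <- r | P j) c j * f j x)) /\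
  \int[mu]_(x in D) (\sum_(j <- r | P j) c j * f j x) =
  \sum_(j <- r | P j) c j * \int[mu]_(x in D) f j x.
Proof.
move=> mD fi; elim: r => [|j r [IHi IH]].
  split; last first.
    by rewrite big_nil; under eq_Rintegral do rewrite big_nil;
      rewrite Rintegral_cst ?mul0r.
  apply: eq_integrable (integrable0 mu D) => // x _ /=.
  by rewrite big_nil.
rewrite big_cons; have [Pj|nPj] := boolP (P j); last first.
  split; last first.
    by rewrite -IH; apply: eq_Rintegral => x _; rewrite big_cons (negPf nPj).
  by apply: eq_integrable IHi => // x _ /=; rewrite big_cons (negPf nPj).
have fj : mu.-integrable D (EFin \o (fun x => c j * f j x)).
  exact: (integrableZl mD (c j) (fi j Pj)).
split.
  apply: eq_integrable (integrableD mD fj IHi) => // x _ /=.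
  by rewrite big_cons Pj.
rewrite -IH -RintegralZl//; last exact: fi.
rewrite -RintegralD//; apply: eq_Rintegral => x _.
by rewrite big_cons Pj.
Qed.

(** From (|f| - 1)^2 >= 0 follows |f| <= 1 + f^2, and the constant 1 is integrable on a set of
    finite measure. *)
Lemma Lfun2_integrable D f : measurable D -> (mu D < +oo)%E ->
  f \_ D \in Lfun mu 2%:E -> mu.-integrable D (EFin \o f).
Proof.
move=> mD Dfin f2.
have := Lfun2_integrable_sqr f2.
move: f2; rewrite inE => /andP[/[!inE]/= mf _] f2.
have mfD : measurable_fun D f by exact/(measurable_restrictT f mD).
have i2 : mu.-integrable D (EFin \o (fun x => f x ^+ 2)).
  apply/(integrable_mkcond _ mD); apply: eq_integrable f2 => // x _ /=.
  by rewrite /patch; case: ifP; rewrite //= expr0n.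
have ic : mu.-integrable D (EFin \o (cst 1)).
  apply: measurable_bounded_integrable => //.
  by apply: (@bounded_on _ _ 1) => z _; rewrite normr1.
apply: le_integrable (integrableD mD ic i2) => //; first exact/measurable_EFinP.
move=> x Dx /=; rewrite lee_fin [leRHS]ger0_norm ?addr_ge0 ?sqr_ge0//.
have := sqr_ge0 (`|f x| - 1); rewrite -(real_normK (num_real (f x))).
have := normr_ge0 (f x); nra.
Qed.

End Integrals.

(** * Solvability of the interior systems by means of the bubble *)

Section BubbleSystem.
Context d (T : measurableType d) (R : realType) (mu : {measure set T -> \bar R}).
Variables (D N : set T) (V : finType) (pos : V -> R3 R) (k : nat) (S : {set V}).
Variables (G : T -> R3 R) (phi : node V k -> R3 R -> R) (r : int).
Hypotheses (mD : measurable D) (Dfin : (mu D < +oo)%E).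
Hypotheses (mN : measurable N) (N0 : mu N = 0%E).
Hypothesis mG : forall i, measurable_fun D (fun z => Defs.coord (G z) i).
Hypothesis GS : forall z, D z -> simplex pos S (G z).
Hypothesis Gpos : forall z, D z -> ~ N z ->
  exists2 w, weights S w /\ {in S, forall i, 0 < w i} & G z = point_of pos w.
Hypothesis phiP :
  {in nodes_on k S, forall a, polyOn (simplex pos S) k.+2 (phi a)}.
Hypothesis phi_nodal :
  {in nodes_on k S &, forall a b, phi a (npoint pos b) = (a == b)%:R}.
Hypothesis rS : r + #|S|%:Z <= k.+2.

Lemma measurable_meval (p : mpoly.mpoly 3 R) :
  measurable_fun D (fun z => mpoly.meval (Defs.coord (G z)) p).
Proof.
under eq_fun do rewrite mpoly.mevalE.
apply: measurable_sum => m; apply: measurable_funM => //.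
by apply: measurable_prod => i _; apply: measurable_funX.
Qed.

Lemma polyOn_measurable s f : polyOn (simplex pos S) s f ->
  measurable_fun D (f \o G).
Proof.
case=> p _ fp; apply: eq_measurable_fun (measurable_meval p) => z.
by rewrite inE => /GS /fp.
Qed.

Lemma polyOn_bounded_comp s f : polyOn (simplex pos S) s f ->
  [bounded (f \o G) z | z in D].
Proof.
by move=> /polyOn_bounded[M fM]; apply: (@bounded_on _ _ _ _ _ M) => z /GS /fM.
Qed.

Lemma polyOn_integrable s f : polyOn (simplex pos S) s f ->
  mu.-integrable D (EFin \o (f \o G)).
Proof.
move=> fP; apply: measurable_bounded_integrable => //.
  exact: polyOn_measurable fP.
exact: polyOn_bounded_comp fP.
Qed.

Lemma integrable_mul_polyOn (h : T -> R) s f : polyOn (simplex pos S) s f ->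
  mu.-integrable D (EFin \o h) ->
  mu.-integrable D (EFin \o (fun z => h z * f (G z))).
Proof.
move=> fP hi; have := integrableMl mD hi (polyOn_measurable fP).
by apply; exact: polyOn_bounded_comp fP.
Qed.

Let interior_node (a : node V k) := (a \in nodes_on k S) && (nsupp a == S).

Lemma bubble_mul_polyE (p : R3 R -> R) : polyOn (simplex pos S) r p ->
  forall w, weights S w ->
  \sum_(a | interior_node a)
     (\prod_(i in S) weights_of_node R a i * p (npoint pos a)) *
        phi a (point_of pos w) =
  \prod_(i in S) w i * p (point_of pos w).
Proof.
case=> m mr pm w Sw.
have [gp pgp gpE] : exists2 gp, poly_fun k.+2 gp &
    forall w, weights S w ->
      \prod_(i in S) w i * p (point_of pos w) = gp w.
  exists (fun w => \prod_(i in S) w i *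
      mpoly.meval (Defs.coord (point_of pos w)) m); last first.
    by move=> w' Sw'; rewrite pm// simplexE; exists w'.
  (* For r = s >= 0 the product has degree at most |S| + s <= k + 2. For r < 0 the polynomial has
     empty support, and the product is zero. *)
  case: r mr rS => [s|s] mr' rS'.
    apply: (@poly_fun_le _ _ (\sum_(i in S) 1 + s)); last first.
      apply: poly_fun_mul; last by apply: poly_fun_meval => u /mr'.
      by apply: poly_fun_prod => i _; exact: poly_fun_coord.
    by rewrite sum1_card addnC -lez_nat PoszD.
  have m0 : mpoly.msupp m = [::].
    by case: (mpoly.msupp m) mr' => // u l /(_ u); rewrite inE eqxx => /(_ isT).
  apply: (@eq_poly_fun _ _ _ (fun=> 0)) => [w'|]; last exact: poly_fun_cst.
  by rewrite mpoly.mevalE m0 big_nil mulr0.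
have [g gP] : exists g : node V k -> (V -> R) -> R, forall a,
    a \in nodes_on k S -> poly_fun k.+2 (g a) /\
      forall w, weights S w -> phi a (point_of pos w) = g a w.
  suff /choice[g gP] : forall a, exists g : (V -> R) -> R,
      a \in nodes_on k S -> poly_fun k.+2 g /\
      forall w, weights S w -> phi a (point_of pos w) = g w.
    by exists g.
  move=> a; have [aS|aS] := boolP (a \in nodes_on k S); last by exists (cst 0).
  by have [g pg gE] := polyOn_poly_fun (phiP aS); exists g.
rewrite gpE//; apply/eqP; rewrite -subr_eq0; apply/eqP.
(* The difference of the two sides as a function of the weights; by unisolvence it only has to
   vanish at the nodes of S. *)
pose F (w : V -> R) := \sum_(a | interior_node a)
  \prod_(i in S) weights_of_node R a i * p (npoint pos a) * g a w + -1 * gp w.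
have -> : \sum_(a | interior_node a)
     \prod_(i in S) weights_of_node R a i * p (npoint pos a) *
     phi a (point_of pos w) - gp w = F w.
  rewrite /F mulN1r; congr (_ - _); apply: eq_bigr => a /andP[aS _].
  by have [_ ->] := gP a aS.
case: (Sw) => _ w2 w3; apply: (@node_unisolvence _ _ k S F) => //.
  apply: poly_fun_add; last exact: poly_fun_scale.
  apply: poly_fun_sum => a /andP[aS _]; apply: poly_fun_scale.
  by have [] := gP a aS.
move=> b bS; have Swb := weights_node R bS.
rewrite /F -gpE// -npointE mulN1r; apply/eqP; rewrite subr_eq0; apply/eqP.
rewrite (eq_bigr (fun a => if a == b then
    \prod_(i in S) weights_of_node R a i * p (npoint pos a) else 0)); last first.
  move=> a /andP[aS _]; have [_ /(_ _ Swb) <-] := gP a aS.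
  by rewrite -npointE phi_nodal// mulr_natr mulrb.
have [bI|] := boolP (interior_node b).
  rewrite (bigD1 b)//= eqxx [X in _ + X]big1 ?addr0// => a /andP[_ /negPf ->//].
rewrite /interior_node bS/= => bI; rewrite big1 => [|a /andP[_ aI]]; last first.
  by case: eqP => // ab; move: bI; rewrite -ab aI.
(* A node of S that is not interior misses some vertex of S; its weight there is a zero factor of
   the bubble. *)
have /existsP[i /andP[iS ib]] : [exists i, (i \in S) && (i \notin nsupp b)].
  apply: contraR bI => /existsPn bI; rewrite finset.eqEsubset nsupp_nodes_on//=.
  by apply/fintype.subsetP => i iS; have := bI i; rewrite iS/= negbK.
rewrite (bigD1 i)//=; move: ib; rewrite -(weights_of_node_eq0 R) => /eqP ->.
by rewrite !mul0r.
Qed.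

Lemma bubble_kernel (p : R3 R -> R) : polyOn (simplex pos S) r p ->
  (forall a, interior_node a -> \int[mu]_(z in D) (phi a (G z) * p (G z)) = 0) ->
  ae_eq mu D (p \o G) (cst 0).
Proof.
move=> pP p0.
pose q (a : node V k) := \prod_(i in S) weights_of_node R a i * p (npoint pos a).
have phi_int a : interior_node a ->
    mu.-integrable D (EFin \o (fun z => phi a (G z) * p (G z))).
  move=> /andP[aS _].
  exact: integrable_mul_polyOn pP (polyOn_integrable (phiP aS)).
have [wint w0] := Rintegral_lincomb (index_enum _) q mD phi_int.
set w := fun z => \sum_(a | interior_node a)
  q a * (phi a (G z) * p (G z)) in wint w0.
(* Multiplying [bubble_mul_polyE] by p identifies the chosen combination of test integrands with
   bubble * p^2. *)
have wE z c : weights S c -> G z = point_of pos c ->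
    w z = \prod_(i in S) c i * p (G z) ^+ 2.
  move=> Sc Gc; rewrite /w Gc expr2 mulrA -bubble_mul_polyE// mulr_suml.
  by apply: eq_bigr => a _; rewrite mulrA.
have w_ge0 z : D z -> 0 <= w z.
  move=> /GS; rewrite simplexE => -[c Sc /esym Gc]; rewrite (wE _ _ Sc Gc).
  by rewrite mulr_ge0 ?sqr_ge0// prodr_ge0// => i _; case: Sc.
have : ae_eq mu D (EFin \o w) (cst 0%E).
  apply/ae_eq_integral_abs => //; first exact: measurable_int wint.
  under eq_integral => z zD.
    by rewrite gee0_abs; [over|rewrite lee_fin w_ge0// -inE].
  have wI : \int[mu]_(z in D) w z = 0.
    by rewrite w0 big1// => a aI; rewrite p0// mulr0.
  have := congr1 EFin wI; rewrite /Rintegral fineK//.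
  exact: integrable_fin_num.
(* [N] joins the exceptional set: where the bubble vanishes, [w z = 0] says nothing about p. *)
move=> [M [mM M0 DM]]; exists (M `|` N); split.
- exact: measurableU.
- by apply/eqP; rewrite measureU0// M0.
- move=> z /= /not_implyP[Dz pz]; have [Nz|nNz] := pselect (N z); first by right.
  left; apply: DM => /= /(_ Dz) [wz].
  have [c [Sc c0] Gc] := Gpos Dz nNz.
  move: wz; rewrite (wE _ _ Sc Gc) => /eqP.
  rewrite mulf_eq0 expf_eq0/= => /orP[|/eqP//].
  by apply/negP; rewrite gt_eqF// prodr_gt0.
Qed.

Lemma bubble_system_solvable (h : T -> R) : mu.-integrable D (EFin \o h) ->
  exists2 q : node V k -> R, (forall a, ~~ interior_node a -> q a = 0) &
    forall p, polyOn (simplex pos S) r p ->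
      \int[mu]_(z in D)
        ((\sum_(a | interior_node a) q a * phi a (G z) + h z) * p (G z)) = 0.
Proof.
move=> hi.
(* [bmultinom 3 K] consists of the exponents of degree strictly below [K]. Hence [K] is r + 1 for r
   >= 0, and 0, which leaves no monomial, for r < 0. *)
pose K := if r is Posz s then s.+1 else 0%N.
pose e (m : mpoly.bmultinom 3 K) (x : R3 R) :=
  mpoly.meval (Defs.coord x) (mpoly.mpolyX R (mpoly.bmnm m)).
have eP m : polyOn (simplex pos S) r (e m).
  exists (mpoly.mpolyX R (mpoly.bmnm m)) => // u.
  rewrite mpoly.msuppX inE => /eqP ->; move: (mpoly.bmdeg m).
  by move: (mpoly.mdeg _) => w; rewrite /K; case: (r).
have phie a m : interior_node a ->
    mu.-integrable D (EFin \o (fun z => phi a (G z) * e m (G z))).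
  move=> /andP[aS _].
  exact: integrable_mul_polyOn (eP m) (polyOn_integrable (phiP aS)).
have he m := integrable_mul_polyOn (eP m) hi.
pose A a m := \int[mu]_(z in D) (phi a (G z) * e m (G z)).
pose L m := - \int[mu]_(z in D) (h z * e m (G z)).
(* One equation per monomial. On a face the monomials in three variables are dependent, so
   consistency has to be shown: a combination of monomials orthogonal to all interior nodal
   functions vanishes almost everywhere on [D], hence pairs to zero with [h] as well. *)
have [c Ac0|q q0 qL] := @fredholm_alternative R _ _ interior_node A L.
  pose p x := \sum_m c m * e m x.
  have pP : polyOn (simplex pos S) r p by apply: polyOn_lincomb => m _; exact: eP.
  have p0 : ae_eq mu D (p \o G) (cst 0).
    apply: bubble_kernel => // a aI; rewrite -[RHS](Ac0 a aI).
    under [RHS]eq_bigr do rewrite mulrC.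
    have [_ <-] := Rintegral_lincomb (P := xpredT) (index_enum _) c mD
      (fun m _ => phie a m aI).
    apply: eq_Rintegral => z _; rewrite /p mulr_sumr.
    by apply: eq_bigr => m _; rewrite mulrCA.
  have [_ hpE] := Rintegral_lincomb (P := xpredT) (index_enum _) c mD
      (fun m _ => he m).
  transitivity (- \int[mu]_(z in D) (h z * p (G z))).
    under eq_Rintegral.
      move=> z _; rewrite /p mulr_sumr; under eq_bigr do rewrite mulrCA; over.
    by rewrite hpE -sumrN; apply: eq_bigr => m _; rewrite /L mulNr mulrC.
  rewrite /Rintegral (ae_eq_integral (cst 0%E)) ?integral0 ?oppr0//.
    exact: measurable_int (integrable_mul_polyOn pP hi).
  by apply: filterS p0 => z /= pz /pz ->; rewrite mulr0.
exists q => // p [u ur pu].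
(* Every test polynomial is a combination of the chosen monomials, so the equations extend to it by
   linearity. *)
have uE : u = \sum_m mpoly.mcoeff (mpoly.bmnm m) u *:
    mpoly.mpolyX R (@mpoly.bmnm 3 K m).
  apply: mpoly.mpolywE; rewrite mpoly.msizeE; apply/bigmax_leqP_seq => m um _.
  by have := ur m um; rewrite /K; case: (r).
pose f m z := (\sum_(a | interior_node a) q a * phi a (G z) + h z) * e m (G z).
have fE m : mu.-integrable D (EFin \o f m) /\ \int[mu]_(z in D) f m z = 0.
  have [si sE] := Rintegral_lincomb (index_enum _) q mD (fun a => phie a m).
  have fmE : f m = (fun z => \sum_(a | interior_node a)
      q a * (phi a (G z) * e m (G z)) + h z * e m (G z)).
    apply/funext => z; rewrite /f mulrDl mulr_suml; congr (_ + _).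
    by apply: eq_bigr => a _; rewrite mulrA.
  rewrite fmE; split; first exact: (integrableD mD si (he m)).
  by rewrite RintegralD// sE qL /L addNr.
transitivity (\int[mu]_(z in D)
    \sum_m mpoly.mcoeff (mpoly.bmnm m) u * f m z).
  apply: eq_Rintegral => z; rewrite inE => /GS /pu ->.
  rewrite [in LHS]uE raddf_sum/= mulr_sumr; apply: eq_bigr => m _.
  by rewrite mpoly.mevalZ mulrCA.
have [_ ->] := Rintegral_lincomb (P := xpredT) (index_enum _)
  (fun m => mpoly.mcoeff (mpoly.bmnm m) u) mD (fun m _ => (fE m).1).
by rewrite big1// => m _; rewrite (fE m).2 mulr0.
Qed.

End BubbleSystem.

(** * Measurability and boundedness in three-dimensional space *)

Section SpaceMeasurability.
Variable R : realType.

Lemma measurable_ball3 (x : R3 R) e : measurable (ball x e).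
Proof.
have -> : ball x e = ball x.1.1 e `*` ball x.1.2 e `*` ball x.2 e.
  by apply/seteqP; split=> -[[y z] t].
by do 2 (apply: measurableX; last exact: measurable_ball); exact: measurable_ball.
Qed.

(** Balls of the maximum norm are boxes, hence measurable in the product structure, and an open set
    is a countable union of balls with rational centres and radii 1 / (n + 1). *)
Lemma open_measurable3 (U : set (R3 R)) : open U -> measurable U.
Proof.
move=> oU.
pose c (q : rat * rat * rat) : R3 R := (ratr q.1.1, ratr q.1.2, ratr q.2).
have cdense (x : R3 R) (e : R) : 0 < e -> exists q, ball (c q) e x.
  move=> e0; suff H (y : R) : exists q, ball (ratr q : R) e y.
    have [[[q1 h1] [q2 h2]] [q3 h3]] := (H x.1.1, H x.1.2, H x.2).
    by exists (q1, q2, q3); split=> //; split.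
  have : y - e < y + e by lra.
  move=> /rat_in_itvoo[q]; rewrite in_itv/= => /andP[yq qy]; exists q.
  by rewrite -ball_normE/= ltr_distlC; lra.
have -> : U = \bigcup_(i : (rat * rat * rat) * nat)
    (if `[<ball (c i.1) i.2.+1%:R^-1 `<=` U>]
     then ball (c i.1) i.2.+1%:R^-1 else set0).
  apply/seteqP; split=> [x Ux|y [[q n] _ /=]]; last first.
    by case: asboolP => // qU /qU.
  have /nbhs_ballP[e /= e0 xU] : nbhs x U by exact: open_nbhs_nbhs.
  have [n ne] : exists n, n.+1%:R^-1 < e / 2.
    have [n] := ltr_add_invr (divr_gt0 e0 (ltr0Sn R 1)).
    by rewrite add0r; exists n.
  have n0 : 0 < n.+1%:R^-1 :> R by rewrite invr_gt0.
  have [q qx] := cdense x _ n0.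
  exists (q, n) => //=; case: asboolP => // -[] y qy; apply: xU.
  apply: (@le_ball _ _ _ (n.+1%:R^-1 + n.+1%:R^-1)).
    by rewrite (splitr e) lerD// ltW.
  by apply: ball_triangle qy; exact: ball_sym.
apply: countable_bigcupT_measurable => // i; case: ifP => // _.
exact: measurable_ball3.
Qed.

Lemma continuous_measurable3 (f : R3 R -> R) : continuous f ->
  measurable_fun setT f.
Proof.
move=> /continuousP cf; apply: (measurability _ (RGenOpens.measurableE R)).
move=> _ [_ [a [b ->] <-]]; rewrite setTI.
by apply: open_measurable3; apply: cf; exact: interval_open.
Qed.

Lemma measurable_coord (i : 'I_3) :
  measurable_fun setT (fun x : R3 R => Defs.coord x i).
Proof.
have m1 : measurable_fun [set: R3 R] (fun x => x.1.1).
  exact: (measurableT_comp measurable_fst measurable_fst).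
have m2 : measurable_fun [set: R3 R] (fun x => x.1.2).
  exact: (measurableT_comp measurable_snd measurable_fst).
by case: i => -[|[|[|//]]] i3;
  [apply: eq_measurable_fun m1|apply: eq_measurable_fun m2|
   apply: eq_measurable_fun measurable_snd] => x _;
  rewrite /Defs.coord (tnth_nth 0).
Qed.

Definition box (M : R) : set (R3 R) :=
  `[- M, M]%classic `*` `[- M, M]%classic `*` `[- M, M]%classic.

Lemma box_compact M : compact (box M).
Proof.
by do 2 (apply: compact_setX; last exact: segment_compact);
  exact: segment_compact.
Qed.

Lemma leb3_box_lty M : (leb3 R (box M) < +oo)%E.
Proof.
rewrite /box /leb3 product_measure1E//; last exact: measurableX.
rewrite /leb2 [X in (X * _)%E]product_measure1E//.
pose I : set R := `[- M, M]%classic.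
have l : (lebesgue_measure I < +oo)%E.
  by rewrite lebesgue_measure_itv/=; case: ifP => // _; exact: ltry.
have lf : lebesgue_measure I \is a fin_num.
  by rewrite ge0_fin_numE.
by rewrite lte_mul_pinfty ?mule_ge0 ?fin_numM.
Qed.

Lemma bounded_sub_box (A : set (R3 R)) : bounded_set A ->
  exists M, A `<=` box M.
Proof.
move=> [M [_ AM]]; exists (M + 1) => x Ax.
have /= : `|x| <= M + 1 by apply: AM => //; rewrite ltrDl.
case: x Ax => -[y z] t _; rewrite prod_normE/= prod_normE/= !ge_max.
by rewrite !ler_norml => /andP[/andP[? ?] ?]; rewrite /box/= !in_itv.
Qed.

Lemma leb3_bounded_lty (A : set (R3 R)) : measurable A -> bounded_set A ->
  (leb3 R A < +oo)%E.
Proof.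
move=> mA /bounded_sub_box[M AM]; apply: le_lt_trans (leb3_box_lty M).
by apply: le_measure; rewrite ?inE//; do 2 apply: measurableX => //.
Qed.

Lemma continuous_bounded3 (A : set (R3 R)) (f : R3 R -> R) : bounded_set A ->
  continuous f -> [bounded f x | x in A].
Proof.
move=> /bounded_sub_box[M AM] cf.
have /compact_bounded[B [Br fB]] : compact (f @` box M).
  apply: continuous_compact; last exact: box_compact.
  exact: continuous_subspaceT.
exists B; split=> // y By x /AM Mx; apply: (fB _ By); by exists x.
Qed.

End SpaceMeasurability.

(** * Open cells *)

Section Cells.
Variables (R : realType) (V : finType) (pos : V -> R3 R).
Implicit Types (S E : {set V}).

Lemma cell_sub_simplex S : cell pos S `<=` simplex pos S.
Proof. exact: interior_subset. Qed.

Lemma measurable_cell S : measurable (cell pos S).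
Proof. by apply: open_measurable3; exact: open_interior. Qed.

Lemma simplex_bounded S : bounded_set (simplex pos S).
Proof.
exists (\sum_i `|pos i|); split=> [|M /ltW SM x]; first exact: num_real.
rewrite simplexE => -[w Sw <-] /=; apply: le_trans SM.
apply: le_trans (ler_norm_sum _ _ _) _; apply: ler_sum => i _.
have [w0 _ _] := Sw; rewrite normrZ ger0_norm//.
by rewrite ler_piMl// (weights_le1 _ Sw).
Qed.

Lemma leb3_cell_lty S : (leb3 R (cell pos S) < +oo)%E.
Proof.
apply: leb3_bounded_lty; first exact: measurable_cell.
have [M [Mr SM]] := simplex_bounded S.
by exists M; split=> // m /SM Sm x /cell_sub_simplex /Sm.
Qed.

(** As x is interior, moving it slightly away from the barycentre u gives a point y = x + e (x - u)
    still in the simplex. Then x = (y + e u) / (1 + e), and the positive weights of u make all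
    weights of x positive. *)
Lemma cell_pos_weights S x : S != finset.set0 -> cell pos S x ->
  exists2 w, weights S w /\ {in S, forall i, 0 < w i} & x = point_of pos w.
Proof.
move=> S0 Sx; have nS : 0 < #|S|%:R :> R by rewrite ltr0n card_gt0.
pose u i : R := if i \in S then #|S|%:R^-1 else 0.
have u1 : \sum_i u i = 1.
  by rewrite -big_mkcond sumr_const -(mulr_natl (_^-1)) divff// gt_eqF.
have u0 i : 0 <= u i by rewrite /u; case: ifP; rewrite // invr_ge0 ltW.
pose y e := x + e *: (x - point_of pos u).
have cy : y e @[e --> 0] --> x.
  have -> : x = y 0 by rewrite /y scale0r addr0.
  by apply: cvgD; [exact: cvg_cst|apply: cvgZr_tmp; exact: cvg_id].
have : \forall e \near (0 : R), simplex pos S (y e) by exact: cy Sx.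
move=> /nbhs_ballP[r /= r0 ry]; pose e := r / 2.
have e0 : 0 < e by rewrite divr_gt0.
have : simplex pos S (y e).
  by apply: ry; rewrite -ball_normE/= sub0r normrN gtr0_norm// /e; lra.
rewrite simplexE => -[w [w0 wS w1] wy].
pose w' i := (1 + e)^-1 * (w i + e * u i).
have e10 : 0 < 1 + e by rewrite addr_gt0.
exists w'; first split.
- split=> [i|i iS|].
  + by rewrite mulr_ge0 ?invr_ge0 ?addr_ge0 ?mulr_ge0// ltW.
  + by rewrite /w' wS// /u (negPf iS) mulr0 addr0 mulr0.
  + by rewrite -mulr_sumr big_split/= w1 -mulr_sumr u1 mulr1 mulVf ?gt_eqF.
- move=> i iS; rewrite mulr_gt0 ?invr_gt0// ltr_wpDl// mulr_gt0//.
  by rewrite /u iS invr_gt0.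
have -> : point_of pos w' = (1 + e)^-1 *: (point_of pos w + e *: point_of pos u).
  rewrite /point_of scaler_sumr -big_split scaler_sumr; apply: eq_bigr => i _ /=.
  by rewrite /w' scalerA -scalerDl scalerA.
rewrite wy /y scalerBr addrA subrK -[X in _ *: (X + _)]scale1r -scalerDl.
by rewrite scalerA mulVf ?scale1r// gt_eqF.
Qed.

End Cells.

(** * Faces and their parametrisation *)

Section Faces.
Variables (R : realType) (V : finType) (pos : V -> R3 R) (E : {set V}).
Hypothesis E3 : #|E| = 3%N.

(** The weights are 1 - s - t, s and t, attached to the vertices in the order of [enum E], which is
    the order used by [vtx]. *)
Lemma face_weights : exists w : R * R -> V -> R,
  [/\ forall z, face_map pos E z = point_of pos (w z),
      forall i, measurable_fun setT (w^~ i),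
      forall z, ref_triangle z -> weights E (w z) &
      forall z, 0 < z.1 -> 0 < z.2 -> z.1 + z.2 < 1 ->
        {in E, forall i, 0 < w z i}].
Proof.
have : uniq (enum E) by exact: enum_uniq.
have EE i : (i \in E) = (i \in enum E) by rewrite mem_enum.
have : size (enum E) = 3%N by rewrite -cardE.
have vE n : vtx pos E n = nth 0 (map pos (enum E)) n by [].
case: (enum E) EE vE => [|e0 [|e1 [|e2 [|]]]]// EE vE _ /= eU.
pose w (z : R * R) i : R :=
  (1 - z.1 - z.2) * (i == e0)%:R + z.1 * (i == e1)%:R + z.2 * (i == e2)%:R.
have sumd e (W : lmodType R) (a : R) (f : V -> W) :
    \sum_i (a * (i == e)%:R) *: f i = a *: f e.
  rewrite (bigD1 e)//= eqxx mulr1 big1 ?addr0// => i /negPf ->.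
  by rewrite mulr0 scale0r.
have w01 z i : 0 <= z.1 -> 0 <= z.2 -> z.1 + z.2 <= 1 -> 0 <= w z i.
  move=> z1 z2 z12; rewrite /w !addr_ge0// mulr_ge0//; lra.
exists w; split.
- move=> z; rewrite /point_of; under eq_bigr do rewrite !scalerDl.
  rewrite !big_split/= !sumd /face_map !vE/= !scalerBl !scalerBr scale1r.
  by rewrite (AC (1*2*2) (1*3*5*2*4)).
- by move=> i; do ?apply: measurable_funD => //;
    apply: measurable_funM => //; do ?apply: measurable_funB.
- move=> z [z1 z2 z12]; split=> [i|i|]; first exact: w01.
    rewrite EE !inE !negb_or => /and3P[/negPf i0 /negPf i1 /negPf i2].
    by rewrite /w i0 i1 i2 !mulr0 !addr0.
  rewrite /w !big_split/=.
  have sumr (e : V) (a : R) : \sum_i a * (i == e)%:R = a.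
    rewrite (bigD1 e)//= eqxx mulr1 big1 ?addr0// => i /negPf ->.
    by rewrite mulr0.
  by rewrite !sumr; ring.
- move=> z z1 z2 z12 i; rewrite EE !inE /w.
  by case: (i == e0); case: (i == e1); case: (i == e2) => //= _;
    rewrite ?mulr0 ?mulr1; lra.
Qed.

Lemma measurable_face_map i :
  measurable_fun setT (fun z => Defs.coord (face_map pos E z) i).
Proof.
have [w [wE mw _ _]] := face_weights.
under eq_fun do rewrite wE coord_point_of.
by apply: measurable_sum => j; apply: measurable_funM.
Qed.

Lemma face_map_simplex z : ref_triangle z -> simplex pos E (face_map pos E z).
Proof.
have [w [wE _ wz _]] := face_weights.
by move=> /wz Ew; rewrite simplexE; exists (w z).
Qed.

End Faces.

(** * The reference triangle and its negligible boundary *)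

Section ReferenceTriangle.
Variable R : realType.

(** The full lines carrying the three sides: they are null sets too, and are level sets of
    measurable functions. *)
Definition ref_triangle_boundary : set (R * R) :=
  [set z | z.1 = 0] `|` [set z | z.2 = 0] `|` [set z | z.1 + z.2 = 1].

Lemma measurable_ref_triangle : measurable (@ref_triangle R).
Proof.
have -> : @ref_triangle R = (fst @^-1` `[0, +oo[) `&` (snd @^-1` `[0, +oo[) `&`
    ((fun z : R * R => z.1 + z.2) @^-1` `]-oo, 1]).
  apply/seteqP; split=> z /=; rewrite !in_itv/= !andbT.
    by case=> ? ? ?; split=> //; split.
  by case=> -[? ?] ?; split.
apply: measurableI; first apply: measurableI.
- by rewrite -[X in measurable X]setTI; exact: measurable_fst.
- by rewrite -[X in measurable X]setTI; exact: measurable_snd.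
- by rewrite -[X in measurable X]setTI; apply: measurable_funD.
Qed.

Lemma leb2_ref_triangle_lty : (leb2 R (@ref_triangle R) < +oo)%E.
Proof.
pose I : set R := `[0, 1]%classic.
apply: (@le_lt_trans _ _ (leb2 R (I `*` I))).
  apply: le_measure; rewrite ?inE//; first exact: measurable_ref_triangle.
    by apply: measurableX; exact: measurable_itv.
  move=> z [z1 z2 z12]; split; rewrite /I/= in_itv/=;
    by apply/andP; split=> //; lra.
rewrite /leb2 product_measure1E//; [|exact: measurable_itv..].
have l : (lebesgue_measure I < +oo)%E.
  by rewrite lebesgue_measure_itv/= lte_fin ltr01 ltry.
have lf : lebesgue_measure I \is a fin_num by rewrite ge0_fin_numE.
exact: lte_mul_pinfty.
Qed.

Lemma measurable_level (f : R * R -> R) a : measurable_fun setT f ->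
  measurable [set z | f z = a].
Proof.
move=> mf; rewrite (_ : mkset _ = f @^-1` [set a])//.
by rewrite -[X in measurable X]setTI; exact: mf.
Qed.

Lemma measurable_ref_triangle_boundary : measurable ref_triangle_boundary.
Proof.
apply: measurableU; last by apply: measurable_level; exact: measurable_funD.
by apply: measurableU; exact: measurable_level.
Qed.

Lemma leb2_ref_triangle_boundary : leb2 R ref_triangle_boundary = 0%E.
Proof.
have U0 A B : measurable A -> measurable B -> leb2 R A = 0%E ->
    leb2 R B = 0%E -> leb2 R (A `|` B) = 0%E.
  by move=> mA mB A0 B0; rewrite -[RHS]A0; exact: measureU0.
apply: (U0).
- by apply: measurableU; exact: measurable_level.
- by apply: measurable_level; exact: measurable_funD.
- apply: (U0); [exact: measurable_level..| |].
    rewrite (_ : mkset _ = [set 0] `*` setT).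
      by rewrite /leb2 product_measure1E// [X in (X * _)%E]lebesgue_measure_set1 mul0e.
    by apply/seteqP; split=> z; [split|case].
  rewrite (_ : mkset _ = setT `*` [set 0]).
    by rewrite /leb2 product_measure1E// [X in (_ * X)%E]lebesgue_measure_set1 mule0.
  by apply/seteqP; split=> z; [split|case].
(* The oblique line is not a product; its sections are single points, so the iterated integral
   vanishes. *)
- rewrite /leb2/= /product_measure1 integral0_eq// => x _ /=.
  rewrite (_ : xsection _ x = [set 1 - x]) ?lebesgue_measure_set1//.
  by apply/seteqP; split=> y; rewrite /xsection/= inE/=; lra.
Qed.

End ReferenceTriangle.

(** * Linear combinations in the Sobolev space of a bounded open set *)

Section Sobolev.
Variables (R : realType) (U : set (R3 R)).
Hypotheses (oU : open U) (bU : bounded_set U).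

Let mU : measurable U. Proof. exact: open_measurable3. Qed.

Lemma L2_integrable u : L2 U u -> (leb3 R).-integrable U (EFin \o u).
Proof. by move=> L2u; apply: Lfun2_integrable => //; exact: leb3_bounded_lty. Qed.

Lemma L2_0 : L2 U (cst 0).
Proof.
rewrite /L2 (_ : _ \_ _ = 0); last by apply/funext => x; rewrite patchE; case: ifP.
by have [] := @Lfun_submod_closed _ _ _ (leb3 R) _ (lee1n 2).
Qed.

Lemma L2_lin c u w : L2 U u -> L2 U w -> L2 U (fun x => c * u x + w x).
Proof.
move=> L2u L2w; rewrite /L2.
rewrite (_ : _ \_ _ = c *: (u \_ U : R3 R -> R) + (w \_ U)); last first.
  apply/funext => x; rewrite !fctE !patchE; case: ifP => // _.
  by rewrite scaler0 addr0.
by have [_] := @Lfun_submod_closed _ _ _ (leb3 R) _ (lee1n 2); exact.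
Qed.

(** On bounded [U] a continuous factor is bounded and L2 functions are integrable, so both sides of
    the weak derivative identity are integrals of integrable functions and split linearly. *)
Lemma L2_mul_continuous u f : L2 U u -> continuous f ->
  (leb3 R).-integrable U (EFin \o (fun x => u x * f x)).
Proof.
move=> /L2_integrable ui cf.
have mf : measurable_fun U f.
  by apply: measurable_funTS; exact: continuous_measurable3.
exact: (@integrableMl _ _ _ (leb3 R) U mU _ f ui mf (continuous_bounded3 bU cf)).
Qed.

Lemma Rintegral_lin_mul c u w f : L2 U u -> L2 U w -> continuous f ->
  \int[leb3 R]_(x in U) ((c * u x + w x) * f x) =
  c * \int[leb3 R]_(x in U) (u x * f x) + \int[leb3 R]_(x in U) (w x * f x).
Proof.
move=> L2u L2w cf; have uf := L2_mul_continuous L2u cf.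
have wf := L2_mul_continuous L2w cf.
rewrite -RintegralZl// -RintegralD//; last first.
  exact: (@integrableZl _ _ _ (leb3 R) U mU c _ uf).
by apply: eq_Rintegral => x _; rewrite mulrDl mulrA.
Qed.

Lemma H1_0 : H1 U (cst 0).
Proof.
split; first exact: L2_0.
move=> i; exists (cst 0); first exact: L2_0.
move=> f _; under eq_Rintegral do rewrite mul0r.
under [X in - X]eq_Rintegral do rewrite mul0r.
by rewrite Rintegral_cst ?mul0r ?oppr0.
Qed.

Lemma H1_lin c u w : H1 U u -> H1 U w -> H1 U (fun x => c * u x + w x).
Proof.
move=> [L2u du] [L2w dw]; split=> [|i]; first exact: L2_lin.
have [gu L2gu ugu] := du i; have [gw L2gw wgw] := dw i.
exists (fun x => c * gu x + gw x); first exact: L2_lin.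
(* Smoothness at order 1 already provides continuity of f and of its partial derivative. *)
move=> f tf; have [/(_ 1%N)[cf /(_ i)[_ /= cdf]] _] := tf.
by rewrite !Rintegral_lin_mul// ugu// wgw// mulrN opprD.
Qed.

Lemma H1_lincomb (J : Type) (s : seq J) (P : pred J) (c : J -> R)
    (f : J -> R3 R -> R) : (forall j, P j -> H1 U (f j)) ->
  H1 U (fun x => \sum_(j <- s | P j) c j * f j x).
Proof.
move=> fP; elim: s => [|j s IHs].
  rewrite (_ : (fun x => _) = cst 0); first exact: H1_0.
  by apply/funext => x; rewrite big_nil.
have [Pj|nPj] := boolP (P j); last first.
  rewrite (_ : (fun x => _) = (fun x => \sum_(j <- s | P j) c j * f j x))//.
  by apply/funext => x; rewrite big_cons (negPf nPj).
rewrite (_ : (fun x => _) =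
    (fun x => c j * f j x + \sum_(j <- s | P j) c j * f j x)).
  by apply: H1_lin => //; exact: fP.
by apply/funext => x; rewrite big_cons Pj.
Qed.

End Sobolev.
(** Serves to enlarge the support of a vertex node to an edge of the same tetrahedron. *)
Lemma subset_card_between (T : finType) (A B : {set T}) (n : nat) :
  A \subset B -> (#|A| <= n <= #|B|)%N ->
  exists e : {set T}, [/\ A \subset e, e \subset B & #|e| = n].
Proof.
elim: n => [|n IHn] AB /andP[An nB].
  by exists A; split=> //; apply/eqP; rewrite -leqn0.
move: An; rewrite leq_eqVlt => /orP[/eqP An|An]; first by exists A.
have [e [Ae eB en]] := IHn AB (introT andP (conj An (ltnW nB))).
have [x xB xe] : exists2 x, x \in B & x \notin e.
  apply/subsetPn; apply: contraL nB => /subset_leq_card.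
  by rewrite en -ltnNge.
exists (x |: e)%SET; split; last by rewrite cardsU1 xe en.
  exact: fintype.subset_trans Ae (finset.subsetUr _ _).
by rewrite finset.subUset finset.sub1set xB.
Qed.

(** * Node classes read off from the size of the support *)

Section NodeClasses.
Variables (V : finType) (k : nat) (Th : {set {set V}}).
Hypothesis Th4 : {in Th, forall T : {set V}, #|T| = 4%N}.
Implicit Types (S T E : {set V}) (a : node V k).

Lemma nodes_on_nodes S T a : T \in Th -> S \subset T ->
  a \in nodes_on k S -> a \in nodes k Th.
Proof.
move=> TTh ST; rewrite !inE => /andP[ak aS]; apply/existsP; exists T.
by rewrite TTh inE ak (fintype.subset_trans aS ST).
Qed.

Lemma card_faces E : E \in faces Th -> #|E| = 3%N.
Proof. by rewrite inE => /andP[/eqP]. Qed.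

Lemma faces_sub E : E \in faces Th -> exists2 T, T \in Th & E \subset T.
Proof. by rewrite inE => /andP[_ /existsP[T /andP[]]]; exists T. Qed.

Lemma corner_nodeE a : a \in nodes k Th -> corner_node Th a = (#|nsupp a| <= 2)%N.
Proof.
move=> aTh; rewrite /corner_node aTh/=; apply/existsP/idP => [[e]|a2].
  rewrite inE => /andP[/andP[/eqP <- _]]; exact: subset_leq_card.
move: aTh; rewrite inE => /existsP[T /andP[TTh /nsupp_nodes_on aT]].
have [|e [ae eT e2]] := subset_card_between (n := 2) aT; first by rewrite a2 Th4.
by exists e; rewrite inE e2 ae andbT/=; apply/existsP; exists T; rewrite TTh.
Qed.

Lemma middle_nodeE a : a \in nodes k Th -> middle_node Th a = (#|nsupp a| == 3)%N.
Proof.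
move=> aTh; rewrite /middle_node aTh/= inE; apply: andb_idr => _.
move: aTh; rewrite inE => /existsP[T /andP[TTh /nsupp_nodes_on aT]].
by apply/existsP; exists T; rewrite TTh.
Qed.

Lemma internal_nodeE a : a \in nodes k Th ->
  internal_node Th a = (#|nsupp a| == 4)%N.
Proof.
move=> aTh; rewrite /internal_node aTh/=; apply/idP/idP => [/Th4 ->//|a4].
move: aTh; rewrite inE => /existsP[T /andP[TTh /nsupp_nodes_on aT]].
suff -> : nsupp a = T by [].
by apply/eqP; rewrite eqEcard aT (eqP a4) Th4.
Qed.

(** Turns the global class into the local condition of the bubble argument: a support with four
    vertices inside T is T itself. *)
Lemma nodes_on_internalE T a : T \in Th ->
  (a \in nodes_on k T) && internal_node Th a =
  (a \in nodes_on k T) && (nsupp a == T).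
Proof.
move=> TTh; apply: andb_id2l => aT.
rewrite internal_nodeE ?(nodes_on_nodes TTh _ aT)//.
by rewrite eqEcard nsupp_nodes_on// eqn_leq -(Th4 TTh) subset_leq_card//
  nsupp_nodes_on.
Qed.

Lemma nodes_on_middleE E a : E \in faces Th ->
  (a \in nodes_on k E) && middle_node Th a =
  (a \in nodes_on k E) && (nsupp a == E).
Proof.
move=> EF; apply: andb_id2l => aE; have [T TTh ET] := faces_sub EF.
rewrite middle_nodeE ?(nodes_on_nodes TTh ET aE)//.
by rewrite eqEcard nsupp_nodes_on// eqn_leq -(card_faces EF) subset_leq_card//
  nsupp_nodes_on.
Qed.

(** The classes are disjoint and exhaustive, since the support of a node of T has at most 2, exactly
    3 or exactly 4 vertices. *)
Lemma big_nodes_on_tetrahedron (R : realType) T (F : node V k -> R) : T \in Th ->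
  \sum_(a in nodes_on k T) F a =
  \sum_(a in nodes_on k T | internal_node Th a) F a +
  \sum_(a in nodes_on k T | middle_node Th a) F a +
  \sum_(a in nodes_on k T | corner_node Th a) F a.
Proof.
move=> TTh; rewrite (bigID (corner_node Th))/= addrC; congr (_ + _).
rewrite (bigID (middle_node Th))/= addrC; congr (_ + _); apply: eq_bigl => a;
  rewrite -!andbA; apply: andb_id2l => aT;
  have aTh := nodes_on_nodes TTh (fintype.subxx T) aT;
  have := subset_leq_card (nsupp_nodes_on aT);
  rewrite (Th4 TTh) ?internal_nodeE// middle_nodeE// corner_nodeE//.
  by case: #|_| => [|[|[|[|[|]]]]].
by case: #|_| => [|[|[|[|[|]]]]].
Qed.

Lemma big_nodes_on_face (R : realType) E (F : node V k -> R) : E \in faces Th ->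
  \sum_(a in nodes_on k E) F a =
  \sum_(a in nodes_on k E | middle_node Th a) F a +
  \sum_(a in nodes_on k E | corner_node Th a) F a.
Proof.
move=> EF; have [T TTh ET] := faces_sub EF.
rewrite (bigID (corner_node Th))/= addrC; congr (_ + _); apply: eq_bigl => a.
apply: andb_id2l => aE; have aTh := nodes_on_nodes TTh ET aE.
have := subset_leq_card (nsupp_nodes_on aE).
rewrite (card_faces EF) middle_nodeE// corner_nodeE//.
by case: #|_| => [|[|[|[|]]]].
Qed.

End NodeClasses.

(** * The systems defining the interpolation operator and the mass identities *)

Section ScottZhangSystems.
Variables (R : realType) (k : nat) (Om : set (R3 R)) (V : finType).
Variables (pos : V -> R3 R) (Th : {set {set V}}) (phi : node V k -> R3 R -> R).
Variables (psi : {set V} -> node V k -> R3 R -> R) (C : node V k -> {set V}).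
Hypothesis Th4 : {in Th, forall T : {set V}, #|T| = 4%N}.
Hypothesis phiP : nodal_basis pos Om Th phi.

Lemma simplex_subset (S T : {set V}) : S \subset T ->
  simplex pos S `<=` simplex pos T.
Proof.
move=> /fintype.subsetP ST x [w [w0 wS w1 ->]]; exists w; split=> // i iT.
by apply: wS; apply: contra iT; exact: ST.
Qed.

Lemma nodal_polyOn (S T : {set V}) a : T \in Th -> S \subset T ->
  a \in nodes k Th -> polyOn (simplex pos S) k.+2 (phi a).
Proof.
move=> TTh ST aTh; have [/(_ a aTh)[_ /(_ T TTh) aT] _] := phiP.
exact: polyOn_subset (simplex_subset ST) aT.
Qed.

(** Apply unisolvence on S itself: [a] differs from every node of S, so [phi a] vanishes at all of
    them. *)
Lemma nodal_simplex_eq0 (S T : {set V}) a x : T \in Th -> S \subset T ->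
  a \in nodes k Th -> a \notin nodes_on k S -> simplex pos S x -> phi a x = 0.
Proof.
move=> TTh ST aTh aS; rewrite simplexE => -[w Sw <-].
have [g pg gE] := polyOn_poly_fun (nodal_polyOn TTh ST aTh).
rewrite gE//; case: (Sw) => _ wS w1; apply: (node_unisolvence pg) wS w1 => b bS.
rewrite -gE; last exact: weights_node.
rewrite -npointE phiP.2//; last exact: nodes_on_nodes TTh ST bS.
by case: eqP => // ab; move: aS; rewrite ab bS.
Qed.

Lemma Q0_simplexE v (S T : {set V}) x : T \in Th -> S \subset T ->
  simplex pos S x ->
  Q0 pos Th phi psi C v x =
  \sum_(a in nodes_on k S) Q0_value pos Th phi psi C v a * phi a x.
Proof.
move=> TTh ST Sx; rewrite /Q0 (bigID (mem (nodes_on k S)))/= [X in _ + X]big1.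
  rewrite addr0; apply: eq_bigl => a; apply: andb_idl.
  exact: nodes_on_nodes TTh ST.
move=> a /andP[aTh aS].
by rewrite (nodal_simplex_eq0 TTh ST aTh aS Sx) mulr0.
Qed.

Lemma Q0_value_middle v a : middle_node Th a ->
  Q0_value pos Th phi psi C v a = middle_value pos Th phi psi C v a.
Proof.
move=> am; have /andP[aTh _] := am; rewrite /Q0_value am corner_nodeE//.
by move: am; rewrite middle_nodeE// => /eqP ->.
Qed.

Lemma Q0_value_internal v a : internal_node Th a ->
  Q0_value pos Th phi psi C v a = internal_value pos Th phi psi C v a.
Proof.
move=> ai; have /andP[aTh _] := ai.
rewrite /Q0_value corner_nodeE// middle_nodeE//.
by move: ai; rewrite (internal_nodeE Th4)// => /eqP ->.
Qed.

(* Where no trace exists, [trace] is the junk value 0, which is in L^2 too, so no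
   trace theorem is needed. *)
Lemma trace_face_L2 E v : E \in faces Th -> face_L2 pos E (trace pos Th E v).
Proof.
move=> EF; rewrite /trace; case: xgetP => [g _ []//|_].
rewrite /face_L2 (_ : _ \_ _ = 0).
  by have [] := @Lfun_submod_closed _ _ _ (leb2 R) _ (lee1n 2).
by apply/funext => z; rewrite patchE; case: ifP.
Qed.

Lemma middle_system_solvable v E : E \in faces Th ->
  exists q, middle_system pos Th phi psi C v E q.
Proof.
move=> EF; have [T TTh ET] := faces_sub EF; have E3 := card_faces EF.
have mRT := @measurable_ref_triangle R.
have RTlty := @leb2_ref_triangle_lty R.
(* The known part of the integrand: corner contributions minus the trace. *)
pose h z := \sum_(c in nodes_on k E | corner_node Th c)
  corner_value pos Th psi C v c * phi c (face_map pos E z)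
  - trace pos Th E v (face_map pos E z).
have mG i : measurable_fun (@ref_triangle R)
    (fun z => Defs.coord (face_map pos E z) i).
  by apply: measurable_funTS; exact: measurable_face_map.
have GS := @face_map_simplex R V pos E E3.
have hi : (leb2 R).-integrable (@ref_triangle R) (EFin \o h).
  have ti := @Lfun2_integrable _ _ _ (leb2 R) _ _ mRT RTlty (trace_face_L2 v EF).
  have cP : polyOn (simplex pos E) k.+2 (fun x =>
      \sum_(c in nodes_on k E | corner_node Th c)
        corner_value pos Th psi C v c * phi c x).
    apply: polyOn_lincomb => c /andP[cE _].
    exact: nodal_polyOn TTh ET (nodes_on_nodes TTh ET cE).
  have ci := @polyOn_integrable _ _ _ (leb2 R) _ V pos E _ mRT RTlty mG GS _ _ cP.
  exact (@integrableB _ _ _ (leb2 R) _ mRT _ _ ci ti).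
have [||||||q q0 qP] := @bubble_system_solvable _ _ _ (leb2 R)
  (@ref_triangle R) (@ref_triangle_boundary R) V pos k E (face_map pos E) phi
  (k%:Z - 1) mRT RTlty _ _ mG GS _ _ _ _ h hi.
- exact: measurable_ref_triangle_boundary.
- exact: leb2_ref_triangle_boundary.
- move=> z Tz Nz; have [w [wE _ wz wpos]] := face_weights pos E3.
  exists (w z); last exact: wE.
  split; first exact: wz.
  (* Off the three lines the inequalities of the triangle are strict. *)
  case: Tz => z1 z2 z12; apply: wpos; rewrite lt_neqAle ?z1 ?z2 ?z12 andbT;
    apply/eqP => ze; apply: Nz.
  + by left; left.
  + by left; right.
  + by right.
- by move=> a aE; exact: nodal_polyOn TTh ET (nodes_on_nodes TTh ET aE).
- by move=> a b aE bE; apply: phiP.2; exact: nodes_on_nodes TTh ET _.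
- by rewrite E3; lia.
exists q; split=> [a|p pP].
  by rewrite nodes_on_middleE//; exact: q0.
(* The Jacobian is a constant factor, and the integral behind it already vanishes. *)
rewrite /face_int -[RHS](mulr0 (face_jac pos E)); congr (_ * _).
rewrite -[RHS](qP p pP); apply: eq_Rintegral => z _ /=.
congr (_ * _); rewrite /h addrA; congr (_ + _ - _).
by apply: eq_bigl => a; rewrite nodes_on_middleE.
Qed.

Lemma internal_system_solvable v T : T \in Th ->
  (leb3 R).-integrable (cell pos T) (EFin \o v) ->
  exists q, internal_system pos Th phi psi C v T q.
Proof.
move=> TTh vi; have TT := fintype.subxx T; have T4 := Th4 TTh.
have mT := @measurable_cell R V pos T.
have Tlty := @leb3_cell_lty R V pos T.
have mG i : measurable_fun (cell pos T) (fun z => Defs.coord z i).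
  by apply: measurable_funTS; exact: measurable_coord.
have GS := @cell_sub_simplex R V pos T.
pose g x := \sum_(m in nodes_on k T | middle_node Th m)
    middle_value pos Th phi psi C v m * phi m x
  + \sum_(c in nodes_on k T | corner_node Th c)
      corner_value pos Th psi C v c * phi c x.
have gP : polyOn (simplex pos T) k.+2 g.
  by apply: polyOnD; apply: polyOn_lincomb => c /andP[cT _];
    exact: nodal_polyOn TTh TT (nodes_on_nodes TTh TT cT).
have gi := @polyOn_integrable _ _ _ (leb3 R) _ V pos T id mT Tlty mG GS _ _ gP.
have hi := @integrableB _ _ _ (leb3 R) _ mT _ _ gi vi.
(* The exceptional set is empty here, because every point of the open cell has positive weights. *)
have [||||||q q0 qP] := @bubble_system_solvable _ _ _ (leb3 R)
  (cell pos T) set0 V pos k T id phi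
  (k%:Z - 2) mT Tlty _ _ mG GS _ _ _ _ (fun x => g x - v x) hi.
- exact: measurable0.
- exact: measure0.
- by move=> z Tz _; apply: cell_pos_weights Tz; rewrite -card_gt0 T4.
- by move=> a aT; exact: nodal_polyOn TTh TT (nodes_on_nodes TTh TT aT).
- by move=> a b aT bT; apply: phiP.2; exact: nodes_on_nodes TTh TT _.
- by rewrite T4; lia.
exists q; split=> [a|p pP]; first by rewrite nodes_on_internalE//; exact: q0.
rewrite /cell_int -[RHS](qP p pP); apply: eq_Rintegral => z _ /=.
congr (_ * _); rewrite /g !addrA; congr (_ + _ + _ - _).
by apply: eq_bigl => a; rewrite nodes_on_internalE.
Qed.

Lemma Q0_face_mass v E p : E \in faces Th -> polyOn (simplex pos E) (k%:Z - 1) p ->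
  face_int pos E (fun x =>
    (trace pos Th E v x - Q0 pos Th phi psi C v x) * p x) = 0.
Proof.
move=> EF pP; have [T TTh ET] := faces_sub EF.
(* The system is stated for the interpolant minus the trace, hence the test function -p. *)
have [_ /(_ _ (polyOnZ (-1) pP))] := xgetPex (cst 0) (middle_system_solvable v EF).
move=> <-; rewrite /face_int; congr (_ * _).
apply: eq_Rintegral => z; rewrite inE => /(face_map_simplex pos (card_faces EF)) Ez.
rewrite mulN1r mulrN -mulNr opprB; congr ((_ - _) * _).
rewrite (Q0_simplexE _ TTh ET Ez) (big_nodes_on_face Th4)//.
congr (_ + _); apply: eq_bigr => a /andP[aE am]; last by rewrite /Q0_value am.
(* A middle value comes from the system of the face [nsupp a], which for a middle node of E is E
   itself. *)
rewrite (Q0_value_middle _ am) /middle_value.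
have : (a \in nodes_on k E) && middle_node Th a by rewrite aE.
by rewrite nodes_on_middleE// => /andP[_ /eqP ->].
Qed.

Lemma Q0_cell_mass v T p : T \in Th ->
  (leb3 R).-integrable (cell pos T) (EFin \o v) ->
  polyOn (simplex pos T) (k%:Z - 2) p ->
  cell_int pos T (fun x => (v x - Q0 pos Th phi psi C v x) * p x) = 0.
Proof.
move=> TTh vi pP.
have [_ /(_ _ (polyOnZ (-1) pP)) <-] :=
  xgetPex (cst 0) (internal_system_solvable TTh vi).
rewrite /cell_int; apply: eq_Rintegral => x; rewrite inE => /cell_sub_simplex Tx.
rewrite mulN1r mulrN -mulNr opprB; congr ((_ - _) * _).
rewrite (Q0_simplexE _ TTh (fintype.subxx T) Tx) (big_nodes_on_tetrahedron Th4)//.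
congr (_ + _ + _); apply: eq_bigr => a /andP[aT ac]; last by rewrite /Q0_value ac.
  rewrite (Q0_value_internal _ ac) /internal_value.
  have : (a \in nodes_on k T) && internal_node Th a by rewrite aT.
  by rewrite nodes_on_internalE// => /andP[_ /eqP ->].
by rewrite (Q0_value_middle _ ac).
Qed.

Lemma Q0_V0 v : open Om -> bounded_set Om ->
  V0 pos k Om Th (Q0 pos Th phi psi C v).
Proof.
move=> oOm bOm; split=> [|T TTh].
  by apply: H1_lincomb => // a aTh; have [/(_ a aTh)[]] := phiP.
by apply: polyOn_lincomb => a aTh; have [/(_ a aTh)[_ /(_ T TTh)]] := phiP.
Qed.

End ScottZhangSystems.

Theorem lemmaA3 (R : realType) (k : nat) (Om : set (R3 R))
    (V : finType) (pos : V -> R3 R) (Th : {set {set V}})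
    (phi : node V k -> R3 R -> R)
    (psi : {set V} -> node V k -> R3 R -> R)
    (C : node V k -> {set V}) :
  polyhedral_domain Om ->
  tetrahedral_partition pos Om Th ->
  nodal_basis pos Om Th phi ->
  dual_basis pos Th phi psi ->
  face_selection pos Om Th C ->
  forall v : R3 R -> R, H1 Om v ->
  [/\ V0 pos k Om Th (Q0 pos Th phi psi C v),
      forall (T : {set V}) (p : R3 R -> R),
        T \in Th -> polyOn (simplex pos T) (k%:Z - 2) p ->
        cell_int pos T (fun x => (v x - Q0 pos Th phi psi C v x) * p x) = 0 &
      forall (E : {set V}) (p : R3 R -> R),
        E \in faces Th -> polyOn (simplex pos E) (k%:Z - 1) p ->
        face_int pos E (fun x =>
          (trace pos Th E v x - Q0 pos Th phi psi C v x) * p x) = 0].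
Proof.
move=> [_ oOm _ bOm [Om_int _]] [Ttetra Om_union _] phiP _ _ v [L2v _].
have Th4 : {in Th, forall T : {set V}, #|T| = 4%N} by move=> T /Ttetra[].
split=> [|T p TTh|E p EF]; [exact: Q0_V0| |exact: (Q0_face_mass _ _ Th4 phiP)].
(* A simplex is only known to lie in the closure of [Om]; its interior lies in [Om] because [Om] is
   the interior of its closure. *)
have cellOm : cell pos T `<=` Om.
  rewrite -Om_int; apply: interiorS; rewrite Om_union => x Tx.
  by exists T.
apply: (Q0_cell_mass _ _ Th4 phiP TTh).
apply: (@integrableS _ _ _ (leb3 R) Om); last exact: L2_integrable.
- exact: open_measurable3.
- exact: measurable_cell.
- exact: cellOm.
Qed.
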